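(* Let $G$ be an $n$-vertex almost-regular expander graph. Then $t_{seq}(G)=\Theta(n)$ and $t_{par}(G)=\Theta(n)$.
   Context: A graph is almost-regular if the ratio of its maximum degree to its minimum degree is bounded above by a constant. A graph is an expander if $1-\lambda_2=\Omega(1)$, where $\lambda_2$ is the second largest absolute eigenvalue of the random walk transition matrix (statements are for sequences of graphs with $n\to\infty$ and constants uniform in the sequence). For a finite connected graph $G=(V,E)$ with $n$ vertices and $v\in V$: Sequential-IDLA from $v$ releases $n$ particles from $v$ one at a time; the first settles at $v$ immediately; each subsequent particle performs a simple random walk from $v$ until it first jumps to a vertex not occupied by a settled particle, where it settles; only then does the next particle start. Parallel-IDLA from $v$: all $n$ particles start at $v$ at time $0$, one settling at $v$ immediately; at each time step every unsettled particle simultaneously takes one simple random walk step; if one or more particles jump to an unoccupied vertex, exactly one (the one of smallest index) settles there. $\tau_{seq}^v(G)$ is the largest number of steps by any particle before settling in Sequential-IDLA, $\tau_{par}^v(G)$ the first time all particles are settled in Parallel-IDLA; $t_{seq}(G)=\max_v\mathbb{E}[\tau_{seq}^v(G)]$, $t_{par}(G)=\max_v\mathbb{E}[\tau_{par}^v(G)]$. *)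

(* Defs.v *)
From HB Require Import structures.
From mathcomp Require Import all_boot all_order all_algebra.
From mathcomp Require Import all_classical all_reals all_analysis.
From mathcomp Require Import complex.

Set Implicit Arguments.
Unset Strict Implicit.
Unset Printing Implicit Defensive.

Import Order.TTheory GRing.Theory Num.Theory.
Import numFieldNormedType.Exports.

Local Open Scope classical_set_scope.
Local Open Scope ring_scope.

Record sgraph := SGraph {
  vertex :> finType;
  edge : rel vertex;
  edge_sym : symmetric edge;
  edge_irrefl : irreflexive edge }.

Definition connected_graph (G : sgraph) : Prop :=
  forall x y : G, connect (@edge G) x y.

Definition degree (G : sgraph) (x : G) : nat := #|[pred y | edge x y]|.

Definition max_degree (G : sgraph) : nat := (\max_(x : G) degree x)%N.

(* Degrees are smaller than #|G|, so the default value #|G| is only attained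
   by the empty graph. *)
Definition min_degree (G : sgraph) : nat := \big[minn/#|G|]_(x : G) degree x.

(* An isolated vertex is absorbing; a connected graph has one only if it has a
   single vertex. *)
Definition step_prob (R : realType) (G : sgraph) (x y : G) : R :=
  if degree x == 0%N then (x == y)%:R
  else if edge x y then (degree x)%:R^-1 else 0.

Definition transition_matrix (R : realType) (G : sgraph) : 'M[R]_#|G| :=
  \matrix_(i, j) step_prob R (enum_val i) (enum_val j).

(* The complex eigenvalues of a real matrix, with algebraic multiplicity. *)
Definition eigenvalues (R : realType) (n : nat) (A : 'M[R]_n) : seq R[i] :=
  sval (closed_field_poly_normal (char_poly (map_mx (real_complex R) A))).

(* Absolute values are sorted in decreasing order and repeated according to
   multiplicity: a bipartite graph, with eigenvalues 1 and -1, has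
   lambda2 = 1. *)
Definition lambda2 (R : realType) (G : sgraph) : R :=
  nth 0 (sort >=%R [seq complex.Re `|z| | z <- eigenvalues (transition_matrix R G)]) 1.

(* Written multiplicatively, to avoid dividing by a zero minimum degree. *)
Definition almost_regular (R : realType) (G : nat -> sgraph) : Prop :=
  exists C : R, forall k, (max_degree (G k))%:R <= C * (min_degree (G k))%:R.

Definition expander (R : realType) (G : nat -> sgraph) : Prop :=
  exists2 c : R, 0 < c & \forall k \near \oo, c <= 1 - lambda2 R (G k).

(* [f = Theta(g)] for an extended-real sequence [f]; in particular [f] is
   eventually finite. *)
Definition Theta (R : realType) (f : nat -> \bar R) (g : nat -> R) : Prop :=
  exists c C : R, [/\ 0 < c, 0 < C &
    \forall k \near \oo, ((c * g k)%:E <= f k)%E /\ (f k <= (C * g k)%:E)%E].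

Section Walks.
Context (R : realType) (d : measure_display) (Omega : measurableType d)
        (P : probability Omega R) (G : sgraph).

Definition path_event (Y : nat -> Omega -> G) (m : nat) (p : nat -> G) :
    set Omega :=
  [set w | forall t, (t <= m)%N -> Y t w = p t].

Definition simple_random_walk (v : G) (Y : nat -> Omega -> G) : Prop :=
  (forall t x, measurable [set w | Y t w = x]) /\
  forall m (p : nat -> G),
    P (path_event Y m p) =
    ((p 0%N == v)%:R * \prod_(t < m) step_prob R (p t) (p t.+1))%:E.

(* The path events of length m form a finite partition of Omega generating the
   sigma-algebra of the first m steps of a walk; as m varies these generate the
   sigma-algebra of the whole walk. Hence this is mutual independence of the n processes
   X 0, ..., X (n - 1). *)
Definition mutually_independent (n : nat) (X : nat -> nat -> Omega -> G) :
    Prop :=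
  forall m (p : nat -> nat -> G),
    P (\bigcap_(i in `I_n) path_event (X i) m (p i)) =
    (\prod_(i < n) P (path_event (X i) m (p i)))%E.

(* [X i t w] is the position of the i-th particle's walk after t steps.
   A particle follows its walk until it settles; the walks continue
   afterwards but what they do then is irrelevant to the processes below. *)
Definition idla_walks (v : G) (X : nat -> nat -> Omega -> G) : Prop :=
  (forall i, (i < #|G|)%N -> simple_random_walk v (X i)) /\
  mutually_independent #|G| X.

End Walks.

Definition first_time (Q : pred nat) : option nat :=
  if pselect (exists t, Q t) is left h then Some (ex_minn h) else None.

Definition time_value (R : realType) (o : option nat) : \bar R :=
  if o is Some t then (t%:R)%:E else +oo%E.

(* The processes are deterministic functions of the array [x] of
   trajectories, [x i t] being the position of particle i after t steps.
   Particles are numbered from 0. *)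
Section Dispersion.
Context (R : realType) (G : sgraph) (v : G) (x : nat -> nat -> G).

Definition settling_time (A : {set G}) (y : nat -> G) : option nat :=
  first_time (fun t => y t \notin A).

(* The vertices occupied once particles 0, ..., i have settled. If some
   particle never settles the value is immaterial: [tau_seq] is then +oo. *)
Fixpoint seq_occupied (i : nat) : {set G} :=
  if i is j.+1 then
    let A := seq_occupied j in
    if settling_time A (x i) is Some t then (x i t |: A)%SET else A
  else [set v]%SET.

(* Particle 0 settles at time 0. *)
Definition tau_seq : \bar R :=
  \big[maxe/0%E]_(1 <= i < #|G|)
    time_value R (settling_time (seq_occupied i.-1) (x i)).

(* One round of the parallel process, from the set [st.1] of occupied
   vertices and the set [st.2] of settled particles. *)
Definition par_step (t : nat) (st : {set G} * {set 'I_#|G|}) :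
    {set G} * {set 'I_#|G|} :=
  let settling := [set i : 'I_#|G| | [&& i \notin st.2, x i t \notin st.1 &
    [forall j : 'I_#|G|,
       ((j < i)%N && (j \notin st.2)) ==> (x j t != x i t)]]]%SET in
  (st.1 :|: [set x (nat_of_ord i) t | i in settling], st.2 :|: settling)%SET.

Fixpoint par_state (t : nat) : {set G} * {set 'I_#|G|} :=
  if t is s.+1 then par_step t (par_state s)
  else ([set v], [set i : 'I_#|G| | nat_of_ord i == 0%N])%SET.

Definition tau_par : \bar R :=
  time_value R (first_time (fun t => (par_state t).2 == [set: 'I_#|G|]%SET)).

End Dispersion.

(* [X v] is the family of walks used for the processes started from v. *)
Definition t_seq (R : realType) (d : measure_display) (Omega : measurableType d)
    (P : probability Omega R) (G : sgraph)
    (X : G -> nat -> nat -> Omega -> G) : \bar R :=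
  \big[maxe/-oo%E]_(v : G) (\int[P]_w tau_seq R v (fun i t => X v i t w))%E.

Definition t_par (R : realType) (d : measure_display) (Omega : measurableType d)
    (P : probability Omega R) (G : sgraph)
    (X : G -> nat -> nat -> Omega -> G) : \bar R :=
  \big[maxe/-oo%E]_(v : G) (\int[P]_w tau_par R v (fun i t => X v i t w))%E.

(* Main.v *)
From HB Require Import structures.
Require Import Defs.
From mathcomp Require Import all_boot all_order all_algebra.
From mathcomp Require Import all_classical all_reals all_analysis.
From mathcomp Require Import fingroup perm spectral sesquilinear complex.
From mathcomp Require Import ring lra.

(** A walk on an almost-regular expander that starts anywhere hits a set of h
    vertices within O(n / sqrt h) steps with probability close to 1: the Green
    function of the set, for the walk killed at rate 1 / T, equals T times the
    stationary mass of the set up to an error that the spectral gap bounds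
    independently of T.  In Parallel-IDLA with fewer than 2 h unsettled
    particles, a union bound over the sets of h particles and h vertices then
    shows that h or more particles remain after O(n / sqrt h) further rounds
    with probability at most 1 / 2; summing over the powers of two h gives
    t_par = O(n).

    For the lower bounds, choose v minimising the Green function
    g(v, v) / deg v of the walk killed at rate 1 / n.  Symmetry of the Green
    function and the bound R(u, v) >= 1 / deg u on effective resistances show
    that from v every other vertex u is missed for time of order n with
    probability bounded below.  In Sequential-IDLA from v the last particle has
    to hit such a vertex u, which is independent of its walk.

    The two processes are compared by dynamic programming: among all the
    strategies for choosing which unsettled particle moves next, always moving
    one with the most remaining moves minimises the probability that every
    particle settles in at most T moves.  This is the parallel schedule, so
    P(tau_par <= T) <= P(tau_seq <= T) for all T. *)

Set Implicit Arguments.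
Unset Strict Implicit.
Unset Printing Implicit Defensive.

Import Order.TTheory GRing.Theory Num.Theory.
Import numFieldNormedType.Exports.

Local Open Scope classical_set_scope.
Local Open Scope ring_scope.

(** * Spectral gap *)

(** [V] also intertwines the characteristic matrices; take determinants and cancel the nonzero
    [\det V]. *)
Lemma char_poly_intertwine (F : fieldType) n (V A B : 'M[F]_n) :
  V \in unitmx -> V *m A = B *m V -> char_poly A = char_poly B.
Proof.
move=> Vu VA.
have E : map_mx polyC V *m char_poly_mx A = char_poly_mx B *m map_mx polyC V.
  by rewrite /char_poly_mx mulmxBr mulmxBl scalar_mxC -!map_mxM VA.
have := congr1 determinant E; rewrite !det_mulmx mulrC => /mulIf; apply.
by rewrite det_map_mx polyC_eq0 -unitfE -unitmxE.
Qed.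

Lemma char_poly_diag (F : fieldType) n (d : 'rV[F]_n) :
  char_poly (diag_mx d) = \prod_i ('X - (d 0 i)%:P).
Proof.
rewrite char_poly_trig; last exact: diag_mx_is_trig.
by apply: eq_bigr => i _; rewrite mxE eqxx mulr1n.
Qed.

(** In decreasing order, a second entry at most [x] would leave at most the first entry above
    [x]. *)
Lemma sort_ge_nth1 (R : realDomainType) (x : R) (s : seq R) :
  (1 < count (> x) s)%N -> x < nth 0 (sort >=%R s) 1.
Proof.
rewrite -(count_sort >=%R); set t := sort _ _.
have : sorted >=%R t by apply: sort_sorted => a b; exact: le_total.
case: t => [|a [|b t]] //=; first by case: (_ < _).
move=> /andP[_ bt]; case: (ltP x b) => //= bx.
have -> : count (> x) t = 0%N.
  apply/eqP; rewrite -leqn0 leqNgt -has_count; apply/hasPn => y yt.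
  rewrite -leNgt; apply: le_trans bx.
  have : transitive (>=%R : rel R) by move=> u v w uv vw; exact: le_trans vw uv.
  by move=> /order_path_min /(_ bt) /allP /(_ y yt).
by rewrite addn0; case: (_ < _).
Qed.

(** * Spectral gap of a real symmetric matrix *)

Section SymmetricGap.
Variables (C : numClosedFieldType) (n : nat) (S : 'M[C]_n).
Local Open Scope sesquilinear_scope.
Hypotheses (S_sym : S \is symmetricmx) (S_real : S \is a realmx).

Lemma char_poly_spectral_diag :
  char_poly S = \prod_i ('X - (spectral_diag S 0 i)%:P).
Proof.
rewrite -char_poly_diag; apply: (char_poly_intertwine (spectral_unit S)).
have /orthomx_spectralP := symmetric_normalmx S_sym S_real.
by move=> {2}->; rewrite !mulmxA mulmxV ?spectral_unit// mul1mx.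
Qed.

(* The eigenvector u spans the only eigenline with eigenvalue larger than lam
   in absolute value, so g is a combination of the other eigenvectors. *)
Lemma symmetric_gap (lam : C) (u g : 'rV[C]_n) :
  lam < 1 -> u \is a realmx -> u != 0 -> u *m S = u ->
  (forall i j : 'I_n, i != j ->
     `|spectral_diag S 0 i| <= lam \/ `|spectral_diag S 0 j| <= lam) ->
  g \is a realmx -> g *m u^T = 0 ->
  (g *m S *m g^T) 0 0 <= lam * (g *m g^T) 0 0.
Proof.
move=> lam1 u_real u0 uS sp2 g_real gu.
have S_normal := symmetric_normalmx S_sym S_real.
set U := spectralmx S; set sp := spectral_diag S.
have Uu : U \is unitarymx by exact: spectral_unitarymx.
have SE : S = U ^t* *m diag_mx sp *m U.
  by have /orthomx_spectralP {1}-> := S_normal; rewrite invmx_unitary.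
have sp_real i : sp 0 i \is Num.real.
  have /hermitian_spectral_diag_real/mxOverP := realsym_hermsym S_sym S_real.
  exact.
have realT (v : 'rV[C]_n) : v \is a realmx -> v ^t* = v^T.
  by move=> vr; rewrite realmxC//; apply/mxOverP => i j; rewrite mxE; exact: (mxOverP vr).
have UUt : U *m U ^t* = 1%:M by exact/unitarymxP.
have UtU : U ^t* *m U = 1%:M by rewrite -invmx_unitary// mulVmx// spectral_unit.
(* [a] and [b] are the coordinates of [g] and [u] in the unitary eigenbasis. *)
set a := g *m U ^t*; set b := u *m U ^t*.
have aE : U *m g^T = a ^t*.
  by rewrite -(realT g)// trmx_mul map_mxM trmxCK.
have bE : U *m u^T = b ^t*.
  by rewrite -(realT u)// trmx_mul map_mxM trmxCK.
have b_eig : b *m diag_mx sp = b.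
  rewrite -[RHS](congr1 (mulmx^~ (U ^t*)) uS) SE !mulmxA /b.
  by rewrite -!mulmxA UUt mulmx1.
have bi i : sp 0 i = 1 \/ b 0 i = 0.
  move/matrixP/(_ 0 i): b_eig; rewrite mul_mx_diag mxE => /eqP.
  rewrite -subr_eq0 -{2}[b 0 i]mulr1 -mulrBr mulf_eq0 subr_eq0.
  by case/orP=> /eqP; [right|left].
have b0 : b != 0.
  apply: contraNneq u0 => b0; rewrite -[u]mulmx1 -UtU mulmxA -/b b0.
  by rewrite mul0mx.
(* The eigenvalue at [i0] is 1, so all the others are at most [lam] in absolute value. Hence [b] is
   supported on [i0], and orthogonality makes [a] vanish there. *)
have [i0 bi0] : exists i, b 0 i != 0.
  apply/existsP; apply: contraNT b0; rewrite negb_exists => /forallP b0.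
  by apply/eqP/rowP => i; have := b0 i; rewrite negbK => /eqP ->; rewrite mxE.
have spi0 : sp 0 i0 = 1 by case: (bi i0) => // /eqP; rewrite (negPf bi0).
have spi i : i != i0 -> `|sp 0 i| <= lam.
  move=> ii0; case: (sp2 _ _ ii0) => //; rewrite -/sp spi0 normr1 => lam1'.
  by have := lt_le_trans lam1 lam1'; rewrite ltxx.
have bi' i : i != i0 -> b 0 i = 0.
  move=> ii0; case: (bi i) => // spi1; have := spi i ii0.
  by rewrite spi1 normr1 => /(lt_le_trans lam1); rewrite ltxx.
have ab : a *m b ^t* = 0.
  by rewrite -bE /a -mulmxA (mulmxA _ U) UtU mul1mx.
have a0 : a 0 i0 = 0.
  have bt i : (b ^t*) i 0 = (b 0 i)^* by rewrite 2!mxE.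
  move/matrixP/(_ 0 0): ab; rewrite mxE (bigD1 i0)//= big1 ?addr0; last first.
    by move=> i ii0; rewrite bt bi'// conjC0 mulr0.
  by rewrite bt [RHS]mxE => /eqP; rewrite mulf_eq0 conjC_eq0 (negPf bi0) orbF => /eqP.
have -> : g *m g^T = a *m a ^t*.
  by rewrite -aE /a -mulmxA (mulmxA _ U) UtU mul1mx.
have -> : g *m S *m g^T = a *m diag_mx sp *m a ^t*.
  by rewrite SE -aE /a !mulmxA.
have at_ i : (a ^t*) i 0 = (a 0 i)^* by rewrite 2!mxE.
rewrite mul_mx_diag !mxE mulr_sumr; apply: ler_sum => i _.
rewrite at_ mxE -/sp; have [->|ii0] := eqVneq i i0; first by rewrite a0 !mul0r mulr0.
rewrite (mulrC (a 0 i)) -mulrA; apply: ler_wpM2r; first exact: mul_conjC_ge0.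
exact: le_trans (real_ler_norm (sp_real i)) (spi i ii0).
Qed.

End SymmetricGap.

(** * The walk as a self-adjoint operator *)

Section Walk.
Variables (R : realType) (G : sgraph).
Implicit Types f h : G -> R.

Definition deg (x : G) : R := (degree x)%:R.

Definition avg f (x : G) : R := \sum_y step_prob R x y * f y.

(** The weight is the unnormalised stationary measure, for which [avg] is self-adjoint. *)
Definition inner f h : R := \sum_x deg x * f x * h x.

Lemma step_prob_ge0 (x y : G) : 0 <= step_prob R x y.
Proof.
by rewrite /step_prob; case: ifP => _; [rewrite ler0n | case: ifP].
Qed.

Lemma sum_step_prob (x : G) : \sum_y step_prob R x y = 1.
Proof.
rewrite /step_prob; have [dx|dx] := eqVneq (degree x) 0%N.
  by rewrite (bigD1 x)//= eqxx big1 ?addr0// => y /negPf yx; rewrite eq_sym yx.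
rewrite -big_mkcond/= sumr_const -/(degree x) -[_ *+ _]mulr_natr mulVf//.
by rewrite pnatr_eq0.
Qed.

(** Detailed balance: both sides are the adjacency indicator. The loop at an isolated vertex has
    weight 0. *)
Lemma deg_step_sym (x y : G) : deg x * step_prob R x y = deg y * step_prob R y x.
Proof.
have half (a b : G) : deg a * step_prob R a b = (edge a b)%:R.
  rewrite /step_prob /deg; have [da|da] := eqVneq (degree a) 0%N.
    rewrite da mul0r; case: (boolP (edge a b)) => // ab.
    by have : (0 < degree a)%N by [apply/card_gt0P; exists b]; rewrite da.
  by case: ifP => _; rewrite ?mulr0// mulfV// pnatr_eq0.
by rewrite !half edge_sym.
Qed.

Lemma step_probxx (x : G) : degree x != 0%N -> step_prob R x x = 0.
Proof. by rewrite /step_prob edge_irrefl => /negPf ->. Qed.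

Lemma innerC f h : inner f h = inner h f.
Proof. by apply: eq_bigr => x _; rewrite -!mulrA (mulrC (f x)). Qed.

Lemma inner_avgC f h : inner f (avg h) = inner (avg f) h.
Proof.
rewrite /inner /avg; under eq_bigr do rewrite mulr_sumr.
rewrite exchange_big /=; apply: eq_bigr => y _.
rewrite mulr_sumr mulr_suml; apply: eq_bigr => x _.
transitivity ((deg x * step_prob R x y) * f x * h y); first by ring.
by rewrite deg_step_sym; ring.
Qed.

Local Open Scope sesquilinear_scope.

(** Conjugation by the diagonal matrix of the square roots of the degrees makes the transition
    matrix symmetric without changing its eigenvalues, and turns constants into the eigenvector
    [u]. *)
Lemma spectral_gap (c : R) : (forall x : G, (0 < degree x)%N) -> 0 < c ->
  c <= 1 - lambda2 R G ->
  forall f, inner f (fun=> 1) = 0 -> inner f (avg f) <= (1 - c) * inner f f.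
Proof.
move=> d0 c0 gap f f1.
case: (pickP (@predT G)) => [x0 _|G0]; last first.
  by rewrite /inner !big_pred0 ?mulr0// => x; have := G0 x.
set n := #|G|; pose e : 'I_n -> G := @enum_val _ _.
pose q (i : 'I_n) : R := Num.sqrt (deg (e i)).
have q2 i : q i * q i = deg (e i) by rewrite -expr2 sqr_sqrtr ?ler0n.
have q0 i : q i != 0 by rewrite gt_eqF// sqrtr_gt0 ltr0n.
pose S : 'M[R]_n := \matrix_(i, j)
  (q i * step_prob R (e i) (e j) * (q j)^-1).
have SE i j : S i j = deg (e i) * step_prob R (e i) (e j)
                      * (q i)^-1 * (q j)^-1.
  by rewrite mxE -q2; field; rewrite !q0.
pose toC := real_complex R.
pose SC := map_mx toC S.
have SC_sym : SC \is symmetricmx.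
  apply/is_hermitianmxP; rewrite expr0 scale1r.
  apply/matrixP => i j; rewrite 3![in RHS]mxE [LHS]mxE; congr (toC _).
  by rewrite !SE deg_step_sym; ring.
have real_map m p (A : 'M[R]_(m, p)) : map_mx toC A \is a realmx.
  by apply/mxOverP => i j; rewrite mxE; apply/Creal_ImP; rewrite -complexIm.
pose V : 'M[R]_n := diag_mx (\row_i q i).
have Vu : map_mx toC V \in unitmx.
  rewrite map_unitmx unitmxE det_diag unitfE prodf_seq_neq0.
  by apply/allP => i _; rewrite mxE q0.
have VP : V *m transition_matrix R G = S *m V.
  apply/matrixP => i j; rewrite mul_diag_mx mul_mx_diag !mxE.
  by rewrite -mulrA mulVf// mulr1.
have cp : char_poly (map_mx toC (transition_matrix R G)) =
    \prod_i ('X - (spectral_diag SC 0 i)%:P).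
  rewrite -(char_poly_spectral_diag SC_sym (real_map _ _ _)).
  apply: (char_poly_intertwine Vu).
  by rewrite -!map_mxM VP.
(* [eigenvalues] is specified only through its product of linear factors, which determines it up to
   order. *)
have ev : perm_eq (eigenvalues (transition_matrix R G))
    [seq spectral_diag SC 0 i | i <- enum 'I_n].
  apply: prod_XsubC_eq.
  rewrite big_map big_enum /= -cp /eigenvalues.
  case: (closed_field_poly_normal _) => r /= ->.
  by rewrite (monicP (char_poly_monic _)) scale1r.
pose u : 'rV[R]_n := \row_i q i.
pose g : 'rV[R]_n := \row_i (q i * f (e i)).
have big_val (F : G -> R) : \sum_x F x = \sum_(i < n) F (e i).
  by rewrite (reindex _ (onW_bij _ (enum_val_bij G))).
have gS : (g *m S *m g^T) 0 0 = inner f (avg f).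
  rewrite /inner big_val mxE.
  have -> : \sum_j (g *m S) 0 j * g^T j 0 =
            \sum_j \sum_i g 0 i * S i j * g 0 j.
    by apply: eq_bigr => j _; rewrite 2!mxE mulr_suml.
  rewrite exchange_big; apply: eq_bigr => i _; rewrite /avg big_val mulr_sumr.
  apply: eq_bigr => j _; rewrite SE !mxE -!q2; field.
  by rewrite !q0.
have gg : (g *m g^T) 0 0 = inner f f.
  rewrite /inner big_val mxE; apply: eq_bigr => i _.
  by rewrite !mxE -q2; ring.
have gu : g *m u^T = 0.
  apply/matrixP => i j; rewrite !ord1 [RHS]mxE -f1 /inner big_val mxE.
  by apply: eq_bigr => k _; rewrite !mxE -q2; ring.
have uS : u *m S = u.
  apply/rowP => j; rewrite mxE; under eq_bigr do rewrite SE deg_step_sym mxE.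
  transitivity (q j * \sum_y step_prob R (e j) y).
    rewrite big_val mulr_sumr; apply: eq_bigr => i _.
    by rewrite -q2; field; rewrite !q0.
  by rewrite sum_step_prob mulr1 mxE.
have := @symmetric_gap _ _ SC SC_sym (real_map _ _ _) (toC (1 - c)) (map_mx toC u) (map_mx toC g).
rewrite !map_trmx -!map_mxM gu uS.
have mapE (A : 'M[R]_1) : map_mx toC A 0 0 = toC (A 0 0) by rewrite mxE.
rewrite !mapE gS gg -rmorphM !lecR map_mx0 => -> //.
- by rewrite ltcR; lra.
- rewrite map_mx_eq0; apply/eqP => /rowP/(_ (enum_rank x0)); rewrite !mxE.
  by move/eqP; rewrite (negPf (q0 _)).
(* Two eigenvalues above [1 - c] in absolute value would push [lambda2] above [1 - c]. *)
- move=> i j ij; set lam := toC (1 - c).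
  case: (boolP (`|spectral_diag SC 0 i| <= lam)) => [|Hi]; first by left.
  case: (boolP (`|spectral_diag SC 0 j| <= lam)) => [|Hj]; first by right.
  have big k : ~~ (`|spectral_diag SC 0 k| <= lam) ->
      1 - c < complex.Re `|spectral_diag SC 0 k|.
    by rewrite normc_def lecR -ltNge.
  suff : 1 - c < lambda2 R G by move=> ?; exfalso; lra.
  apply: sort_ge_nth1; rewrite count_map (seq.permP ev) count_map.
  rewrite -sum1_count big_enum_cond /= sum1_card; apply/card_gt1P.
  by exists i, j; split; rewrite ?ij// unfold_in /=; exact: big.
Qed.
End Walk.

(** * Resolvent of the walk *)

Section Resolvent.
Variables (R : realType) (G : sgraph).
Implicit Types (f g h : G -> R) (s c : R).
Hypothesis deg_pos : forall x : G, (0 < degree x)%N.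

Lemma deg_gt0 (x : G) : 0 < deg R x. Proof. by rewrite ltr0n. Qed.

Lemma innerDl f g h : inner (fun x => f x + g x) h = inner f h + inner g h.
Proof. by rewrite -big_split; apply: eq_bigr => x _ /=; ring. Qed.

Lemma innerZl a f h : inner (fun x => a * f x) h = a * inner f h.
Proof. by rewrite mulr_sumr; apply: eq_bigr => x _; ring. Qed.

Lemma innerDr f g h : inner h (fun x => f x + g x) = inner h f + inner h g.
Proof. by rewrite innerC innerDl !(innerC h). Qed.

Lemma innerZr a f h : inner h (fun x => a * f x) = a * inner h f.
Proof. by rewrite innerC innerZl innerC. Qed.

Lemma avgD f g x : avg (fun x => f x + g x) x = avg f x + avg g x.
Proof. by rewrite -big_split; apply: eq_bigr => y _ /=; ring. Qed.

Lemma avgZ a f x : avg (fun x => a * f x) x = a * avg f x.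
Proof. by rewrite mulr_sumr; apply: eq_bigr => y _; ring. Qed.

Lemma avg_cst (a : R) (x : G) : avg (fun=> a) x = a.
Proof. by rewrite /avg -mulr_suml sum_step_prob mul1r. Qed.

Lemma inner_ge0 f : 0 <= inner f f.
Proof. by apply: sumr_ge0 => x _; rewrite -mulrA mulr_ge0 ?ler0n// -expr2 sqr_ge0. Qed.

Lemma inner_pointwise f x : deg R x * f x ^+ 2 <= inner f f.
Proof.
rewrite /inner (bigD1 x)//= expr2 mulrA lerDl; apply: sumr_ge0 => y _.
by rewrite -mulrA mulr_ge0 ?ler0n// -expr2 sqr_ge0.
Qed.

(** Twice the difference is the Dirichlet form, a weighted sum of the squares [(f x - f y) ^+ 2]. *)
Lemma inner_avg_le f : inner f (avg f) <= inner f f.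
Proof.
pose w (x y : G) : R := deg R x * step_prob R x y.
have w_ge0 x y : 0 <= w x y by rewrite mulr_ge0 ?ler0n ?step_prob_ge0.
have E1 : inner f f = \sum_x \sum_y w x y * f x ^+ 2.
  apply: eq_bigr => x _; rewrite -mulr_suml -mulr_sumr sum_step_prob mulr1.
  by rewrite expr2 mulrA.
have E2 : inner f f = \sum_x \sum_y w x y * f y ^+ 2.
  rewrite E1 exchange_big; apply: eq_bigr => x _; apply: eq_bigr => y _.
  by rewrite /w deg_step_sym.
have E3 : inner f (avg f) = \sum_x \sum_y w x y * (f x * f y).
  apply: eq_bigr => x _; rewrite mulr_sumr; apply: eq_bigr => y _.
  by rewrite /w; ring.
rewrite -subr_ge0 -(pmulr_rge0 _ (ltr0Sn _ 1)).
have -> : 2 * (inner f f - inner f (avg f)) =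
    \sum_x \sum_y w x y * (f x - f y) ^+ 2.
  rewrite mulrBr mulrDl mul1r {1}E1 E2 E3 mulr_sumr -big_split -sumrB.
  apply: eq_bigr => x _; rewrite mulr_sumr -big_split -sumrB.
  by apply: eq_bigr => y _ /=; ring.
by apply: sumr_ge0 => x _; apply: sumr_ge0 => y _; rewrite mulr_ge0 ?sqr_ge0.
Qed.

Lemma resolvent_form_ge0 s f : 0 <= s <= 1 -> 0 <= inner f f - s * inner f (avg f).
Proof.
move=> /andP[s0 s1]; have := inner_avg_le f; have := inner_ge0 f => f0 fle.
have : s * inner f (avg f) <= s * inner f f by rewrite ler_wpM2l.
have : s * inner f f <= 1 * inner f f by rewrite ler_wpM2r.
lra.
Qed.

(** The operator [1 - s * avg] is injective, because its quadratic form is at least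
    [(1 - s) * inner f f]; in finite dimension it is then invertible. *)
Lemma resolvent_exists s h : 0 <= s < 1 ->
  exists g, forall x, g x - s * avg g x = h x.
Proof.
move=> /andP[s0 s1].
pose V := {ffun G -> R^o}.
pose phi (g : V) : V := [ffun x => g x - s * avg g x].
have phi_lin : linear phi.
  move=> a f g; apply/ffunP => x; rewrite !ffunE.
  have -> : avg (a *: f + g) x = a * avg f x + avg g x.
    rewrite -avgZ -avgD; apply: eq_bigr => y _; by rewrite !ffunE.
  by rewrite /GRing.scale /=; ring.
pose phiL : {linear V -> V} := HB.pack phi (GRing.isLinear.Build _ _ _ _ phi phi_lin).
have phi_inj : injective phi.
  apply: (@raddf_inj _ _ phiL) => g /ffunP g0.
  have E x : g x = s * avg g x.
    by have := g0 x; rewrite !ffunE => /eqP; rewrite subr_eq0 => /eqP.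
  have : inner g g = s * inner g (avg g).
    by rewrite -innerZr; apply: eq_bigr => x _; rewrite -E.
  have := inner_avg_le g; have := inner_ge0 g => gg0 gle gE.
  have gg : inner g g = 0 by nra.
  apply/ffunP => x; rewrite ffunE; apply/eqP.
  have := inner_pointwise g x; rewrite gg => le0.
  rewrite -sqrf_eq0 -(mulrI_eq0 _ (mulfI (lt0r_neq0 (deg_gt0 x)))).
  by rewrite eq_le le0 mulr_ge0 ?sqr_ge0 ?ltW ?deg_gt0.
pose L : 'End(V) := linfun phiL.
have L0 : lker L == 0%VS.
  by apply/lker0P => f g; rewrite !lfunE /= => /phi_inj.
exists (fun x => (L^-1)%VF [ffun x => h x] x) => x.
have := lker0_lfunVK L0 [ffun x => h x]; rewrite lfunE /= => /ffunP/(_ x).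
by rewrite !ffunE.
Qed.

(* Maximum principle: look at a minimum of g. *)
Lemma resolvent_ge0 s g h : 0 <= s < 1 ->
  (forall x, g x - s * avg g x = h x) -> (forall x, 0 <= h x) ->
  forall x, 0 <= g x.
Proof.
move=> /andP[s0 s1] gE h0 x.
have [y _ ymin] := @arg_minP _ _ _ x predT g isT.
apply: le_trans (ymin x isT).
have : g y <= avg g y.
  rewrite -[leLHS](avg_cst _ y); apply: ler_sum => z _.
  by rewrite ler_wpM2l ?step_prob_ge0// ymin.
have := gE y; have := h0 y => hy gy gav.
have : s * g y <= s * avg g y by rewrite ler_wpM2l.
nra.
Qed.

Definition vol : R := \sum_(x : G) deg R x.

Lemma vol_gt0 (x : G) : 0 < vol.
Proof.
rewrite /vol (bigD1 x)//= ltr_wpDr ?deg_gt0// sumr_ge0// => y _.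
Qed.

Lemma inner_cst (a : R) : inner (fun _ : G => a) (fun=> 1) = a * vol.
Proof. by rewrite mulr_sumr; apply: eq_bigr => x _; ring. Qed.

(* The resolvent of h is 1 / (1 - s) times the mean of h up to an error that
   the spectral gap bounds independently of s. *)
Lemma resolvent_osc s c g h : 0 <= s < 1 -> 0 < c <= 1 ->
  (forall f, inner f (fun=> 1) = 0 -> inner f (avg f) <= (1 - c) * inner f f) ->
  (forall x, g x - s * avg g x = h x) ->
  forall x, c ^+ 2 * deg R x *
    (g x - (1 - s)^-1 * (inner h (fun=> 1) / vol)) ^+ 2 <= inner h h.
Proof.
move=> /andP[s0 s1] /andP[c0 c1] gap gE x.
have vol0 := vol_gt0 x.
set m := inner h (fun=> 1) / vol; set T := (1 - s)^-1.
have Ts : T * (1 - s) = 1 by rewrite mulVf// gt_eqF// subr_gt0.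
(* The centred resolvent: [f] is orthogonal to constants and solves the equation with right-hand
   side [h - m]. *)
pose f y := g y + (-1) * (T * m).
have hE : inner h (fun=> 1) = (1 - s) * inner g (fun=> 1).
  have -> : inner h (fun=> 1) = inner (fun x => g x + (- s) * avg g x) (fun=> 1).
    by apply: eq_bigr => y _; rewrite -gE mulNr.
  rewrite innerDl innerZl -inner_avgC.
  have -> : inner g (avg (fun=> 1)) = inner g (fun=> 1).
    by apply: eq_bigr => y _; rewrite avg_cst.
  by ring.
have fE y : f y + (- s) * avg f y = h y + (- m).
  rewrite /f avgD avg_cst -gE.
  have E : m = T * m * (1 - s) by rewrite mulrAC Ts mul1r.
  by rewrite [in RHS]E; ring.
have f1 : inner f (fun=> 1) = 0.
  rewrite /f innerDl inner_cst -mulrA mulN1r.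
  have -> : T * m * vol = T * inner h (fun=> 1) by rewrite /m -mulrA divfK// gt_eqF.
  by rewrite hE mulrA Ts mul1r subrr.
(* The constant [m] drops out against [f], and the gap leaves the factor [1 - s * (1 - c)], which is
   at least [c]. *)
have key : c * inner f f <= inner f h.
  have : inner f (fun y => f y + (- s) * avg f y) = inner f h.
    have -> : inner f h = inner f (fun y => h y + (- m) * 1).
      by rewrite innerDr innerZr f1 mulr0 addr0.
    by apply: eq_bigr => y _; rewrite fE mulr1.
  rewrite innerDr innerZr => <-.
  have := gap f f1; have := inner_ge0 f => ff fg.
  have : s * inner f (avg f) <= s * ((1 - c) * inner f f) by rewrite ler_wpM2l.
  have : 0 <= (1 - s) * (1 - c) * inner f f by rewrite !mulr_ge0//; lra.
  by lra.
(* With [key], the square of [c f - h] plays the part of Cauchy-Schwarz and yields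
   [c ^+ 2 * inner f f <= inner h h]. *)
have sq : 0 <= inner (fun y => c * f y + (-1) * h y) (fun y => c * f y + (-1) * h y).
  exact: inner_ge0.
rewrite innerDl !innerDr !innerZl !innerZr (innerC h f) in sq.
have := inner_pointwise f x; rewrite /f -/m -/T => fx.
have -> : g x - T * m = g x + -1 * (T * m) by ring.
rewrite -mulrA; apply: (@le_trans _ _ (c ^+ 2 * inner f f)).
  by rewrite ler_wpM2l ?sqr_ge0.
nra.
Qed.
End Resolvent.

(** * Hitting estimates *)

(** A polynomial substitute for the decay [exp (- t / T)]: each further factor [1 - T^-1] absorbs
    the growth of [1 + t / T]. *)
Lemma expr_le_inv (R : realFieldType) (T : R) t : 1 <= T ->
  (1 - T^-1) ^+ t * (1 + t%:R / T) <= 1.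
Proof.
move=> T1; have T0 : 0 < T by lra.
have d0 : 0 <= T^-1 by rewrite invr_ge0 ltW.
have d1 : T^-1 <= 1 by rewrite invf_le1.
elim: t => [|t]; first by rewrite expr0 mul0r addr0 mul1r.
apply: le_trans; rewrite exprSr -mulrA; apply: ler_wpM2l.
  by apply: exprn_ge0; lra.
by rewrite -natr1; have := ler0n R t; nra.
Qed.

Lemma bernoulli (R : realFieldType) (d : R) t : 0 <= d <= 1 ->
  1 - t%:R * d <= (1 - d) ^+ t.
Proof.
move=> /andP[d0 d1]; elim: t => [|t IH]; first by rewrite expr0 mul0r subr0.
rewrite exprS -natr1; have := ler_wpM2l (_ : 0 <= 1 - d) IH.
have := ler0n R t => t0; move=> H; have := H (ltac:(lra)); nra.
Qed.

Section Hitting.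
Variables (R : realType) (G : sgraph).

Lemma resolvent_formD (s a : R) (f e : G -> R) :
  inner (fun x => f x + a * e x) (fun x => f x + a * e x) -
    s * inner (fun x => f x + a * e x) (avg (fun x => f x + a * e x)) =
  (inner f f - s * inner f (avg f)) + 2 * a * (inner e f - s * inner e (avg f))
  + a ^+ 2 * (inner e e - s * inner e (avg e)).
Proof.
have E h : inner h (avg (fun x => f x + a * e x)) = inner h (avg f) + a * inner h (avg e).
  by rewrite !inner_avgC innerDr innerZr.
rewrite !E !innerDl !innerDr !innerZl !innerZr (innerC f e).
by rewrite (inner_avgC f e) (innerC _ e); ring.
Qed.

(* Probability that the walk from x is outside S at the times 1, ..., t. *)
Fixpoint avoid (S : {set G}) (t : nat) (x : G) : R :=
  if t is t'.+1 then avg (fun y => if y \in S then 0 else avoid S t' y) x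
  else 1.

Lemma avg_le (f h : G -> R) x : (forall y, f y <= h y) -> avg f x <= avg h x.
Proof. by move=> fh; apply: ler_sum => y _; rewrite ler_wpM2l ?step_prob_ge0. Qed.

Lemma avoid_ge0 S t x : 0 <= avoid S t x.
Proof.
elim: t x => [|t IH] x /=; first exact: ler01.
by rewrite -[leLHS](avg_cst _ x); apply: avg_le => y; case: ifP.
Qed.

Lemma avoid_le1 S t x : avoid S t x <= 1.
Proof.
elim: t x => [|t IH] x //=.
by rewrite -[leRHS](avg_cst _ x); apply: avg_le => y; case: ifP.
Qed.

(** Off [S], [F] is harmonic for the walk killed with probability [1 - s] at each step. So [F x] is
    at most the probability of hitting [S] within [t] steps plus the probability [s ^+ t] of
    surviving [t] steps. *)
Lemma avoid_le (S : {set G}) (s : R) F t x : 0 <= s <= 1 -> (forall y, F y <= 1) ->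
  (forall y, y \notin S -> F y = s * avg F y) ->
  x \notin S -> avoid S t x <= 1 - F x + s ^+ t.
Proof.
move=> /andP[s0 s1] F1 FE; elim: t x => [|t IH] x xS.
  by rewrite expr0 /=; have := F1 x; lra.
rewrite FE// -avgZ -lerBlDr.
set k := fun y => if y \in S then 0 else avoid S t y.
have -> : avoid S t.+1 x = avg k x by [].
have -> : avg k x - s ^+ t.+1 = avg (fun y => k y + - s ^+ t.+1) x.
  by rewrite avgD avg_cst.
have -> : 1 - avg (fun y => s * F y) x = avg (fun y => 1 + (-1) * (s * F y)) x.
  by rewrite [RHS]avgD avg_cst [X in _ = _ + X]avgZ mulN1r.
apply: avg_le => y; rewrite /k exprS.
have sF : s * F y <= s * 1 by rewrite ler_wpM2l.
have st : 0 <= s ^+ t by exact: exprn_ge0.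
case: ifPn => [yS|yS]; first by nra.
have := IH y yS; have := avoid_le1 S t y; nra.
Qed.

(** For the same killed walk, [F x] is at least the probability of hitting [u] within [t] steps
    times that of surviving [t] steps. *)
Lemma avoid_ge (u : G) (s : R) F t x : 0 <= s <= 1 -> (forall y, 0 <= F y) -> F u = 1 ->
  (forall y, y != u -> F y = s * avg F y) ->
  x != u -> s ^+ t * (1 - avoid [set u] t x) <= F x.
Proof.
move=> /andP[s0 s1] F0 Fu FE.
(* For the induction, a visit to [u] at time 0 must count as a hit. *)
suff H y : s ^+ t * (1 - (if y \in [set u]%SET then 0 else avoid [set u] t y)) <= F y.
  by move=> xu; have := H x; rewrite finset.in_set1 (negPf xu).
elim: t y => [|t IH] y; rewrite finset.in_set1; have [->|yu] := eqVneq y u.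
- by rewrite Fu expr0 subr0 mul1r.
- by rewrite /= subrr mulr0.
- by rewrite Fu subr0 mulr1 exprn_ile1.
rewrite FE// exprS -mulrA; apply: ler_wpM2l => //=.
set k := fun y => if _ then _ else _.
have -> : s ^+ t * (1 - avg k y) = avg (fun y => s ^+ t * (1 + (-1) * k y)) y.
  by rewrite [RHS]avgZ avgD avg_cst [X in _ = _ * (_ + X)]avgZ mulN1r.
by apply: avg_le => z; rewrite mulN1r /k; have := IH z.
Qed.

Hypothesis deg_pos : forall x : G, (0 < degree x)%N.
Variables (c C : R).
Hypotheses (c01 : 0 < c <= 1)
  (gap : forall f : G -> R, inner f (fun=> 1) = 0 ->
           inner f (avg f) <= (1 - c) * inner f f)
  (deg_le : forall x y : G, deg R x <= C * deg R y).

Lemma vol_le (x : G) : vol R G <= C * #|G|%:R * deg R x.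
Proof.
rewrite mulrAC mulr_natr -[_ *+ _](sumr_const (mem G)) ; apply: ler_sum => y _.
exact: deg_le.
Qed.

Lemma vol_ge (x : G) : #|G|%:R * deg R x <= C * vol R G.
Proof.
rewrite mulrC mulr_natr -[_ *+ _](sumr_const (mem G)) mulr_sumr.
apply: ler_sum => y _; exact: deg_le.
Qed.

(** The Green function [g] of [S] is within a fraction 1/128 of the constant [m0]. Divided by its
    upper bound, it is an almost constant function close to 1 to which [avoid_le] applies. *)
Lemma avoid_upper (S : {set G}) (T : R) t x : 1 <= T ->
  (128 * C * #|G|%:R) ^+ 2 <= (c * T) ^+ 2 * #|S|%:R -> 63 * T <= t%:R ->
  x \notin S -> avoid S t x <= 32^-1.
Proof.
move=> T1 TS tT xS.
set s := 1 - T^-1.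
have T0 : 0 < T by lra.
have Ti0 : 0 < T^-1 by rewrite invr_gt0.
have Ti1 : T^-1 <= 1 by rewrite invf_le1.
have s01 : 0 <= s < 1 by rewrite /s; lra.
have [g gE] := resolvent_exists deg_pos (fun y => (y \in S)%:R) s01.
have V0 := vol_gt0 R deg_pos x.
set V := vol R G in V0 *.
set dS := inner (fun y => (y \in S)%:R) (fun _ : G => 1 : R).
have dSE : inner (fun y => (y \in S)%:R) (fun y => (y \in S)%:R) = dS.
  apply: eq_bigr => y _; by case: (y \in S); rewrite ?mulr0 ?mulr1.
have osc y := resolvent_osc deg_pos s01 c01 gap gE y.
have TE : (1 - s)^-1 = T by rewrite /s opprB addrC subrK invrK.
have n0 : 0 < #|G|%:R :> R by rewrite ltr0n; apply/card_gt0P; exists x.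
have dx0 : 0 < deg R x by exact: deg_gt0.
have C0 : 0 < C.
  by have := deg_le x x; rewrite -subr_ge0 -{2}[deg R x]mul1r -mulrBl pmulr_lge0//; lra.
have S0 : 0 < #|S|%:R :> R.
  rewrite lt0r ler0n andbT; apply: contraTneq TS => ->.
  by rewrite mulr0 -ltNge exprn_gt0// !mulr_gt0.
have dSn : #|S|%:R * V <= C * #|G|%:R * dS.
  have -> : #|S|%:R * V = \sum_(y in S) V by rewrite sumr_const mulr_natl.
  rewrite mulr_sumr [leLHS]big_mkcond /=.
  apply: ler_sum => y _; case: (y \in S); last by rewrite !mulr0 mul0r mulr0.
  by rewrite !mulr1 vol_le.
have dS0 : 0 < dS.
  have H : 0 < C * #|G|%:R * dS by apply: lt_le_trans dSn; rewrite mulr_gt0.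
  by move: H; rewrite pmulr_rgt0// mulr_gt0.
set m0 := T * (dS / V).
have m00 : 0 < m0 by rewrite mulr_gt0// divr_gt0.
(* Combines [vol <= C n deg y], the bound [dSn] on the mass of [S], and the assumed lower bound on
   [T]; the common factor [#|S|] is cancelled. *)
have sq y : (128 * (g y - m0)) ^+ 2 <= m0 ^+ 2.
  have := osc y; rewrite dSE TE -/dS -/V -/m0; set q := (g y - m0) ^+ 2 => qle.
  have q0 : 0 <= q by exact: sqr_ge0.
  have dy0 : 0 < deg R y by exact: deg_gt0.
  rewrite exprMn -/q /m0 exprMn exprMn exprVn mulrA ler_pdivlMr ?exprn_gt0//.
  have H1 : #|S|%:R * V ^+ 2 <= (C * #|G|%:R) ^+ 2 * (deg R y * dS).
    have -> : (C * #|G|%:R) ^+ 2 * (deg R y * dS) =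
      (C * #|G|%:R * dS) * (C * #|G|%:R * deg R y) by ring.
    rewrite expr2 mulrA; apply: ler_pM; rewrite ?mulr_ge0 ?(ltW V0)//.
    exact: vol_le.
  rewrite -(ler_pM2l S0).
  have -> : #|S|%:R * (128 ^+ 2 * q * V ^+ 2) = 128 ^+ 2 * q * (#|S|%:R * V ^+ 2) by ring.
  apply: (@le_trans _ _ ((128 * C * #|G|%:R) ^+ 2 * (q * (deg R y * dS)))).
    have -> : (128 * C * #|G|%:R) ^+ 2 * (q * (deg R y * dS)) =
      128 ^+ 2 * q * ((C * #|G|%:R) ^+ 2 * (deg R y * dS)) by ring.
    by rewrite ler_wpM2l// mulr_ge0 ?sqr_ge0.
  apply: (@le_trans _ _ ((c * T) ^+ 2 * #|S|%:R * (q * (deg R y * dS)))).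
    by rewrite ler_wpM2r// mulr_ge0// ltW// mulr_gt0.
  have -> : (c * T) ^+ 2 * #|S|%:R * (q * (deg R y * dS)) =
     #|S|%:R * T ^+ 2 * dS * (c ^+ 2 * deg R y * q) by ring.
  have -> : #|S|%:R * (T ^+ 2 * dS ^+ 2) = #|S|%:R * T ^+ 2 * dS * dS by ring.
  by rewrite ler_wpM2l// ltW// !mulr_gt0// exprn_gt0.
have bd y : 127 / 128 * m0 <= g y <= 129 / 128 * m0.
  have := sq y; rewrite -ler_sqrt ?sqr_ge0// !sqrtr_sqr (gtr0_norm m00) ler_norml.
  by move=> /andP[? ?]; apply/andP; split; lra.
set m := 129 / 128 * m0.
have mp : 0 < m by rewrite /m; lra.
have F1 y : m^-1 * g y <= 1.
  by rewrite mulrC ler_pdivrMr// mul1r; case/andP: (bd y).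
apply: (le_trans (avoid_le (s := s) _ _ F1 _ xS)).
- by case/andP: s01 => ? /ltW ->; apply/andP.
- move=> y yS; have := gE y; rewrite (negPf yS) => /eqP; rewrite subr_eq0 => /eqP gy.
  by rewrite avgZ {1}gy mulrCA.
(* The two errors 2/129 and 1/64 add up to less than 1/32. *)
have Fx : 127 / 129 <= m^-1 * g x.
  by rewrite [leRHS]mulrC ler_pdivlMr// /m; case/andP: (bd x) => + _; lra.
have st : s ^+ t <= 64^-1.
  have st0 : 0 <= s ^+ t by apply: exprn_ge0; case/andP: s01.
  have := expr_le_inv t T1; rewrite -/s.
  have : 63 <= t%:R / T by rewrite ler_pdivlMr.
  nra.
lra.
Qed.

(** Here [g u x] is the mean number of visits to [u] from [x], with killing rate [1 / n], and
    [g u v / g u u] is a killed hitting probability. It is bounded away from 1 because [g u u] is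
    bounded and exceeds [g u v] by at least 1/2. *)
Lemma avoid_lower : (1 < #|G|)%N ->
  exists v : G, forall (u : G) t, u != v -> t%:R * (4 * (C + c^-1)) <= #|G|%:R ->
    (4 * (C + c^-1))^-1 <= avoid [set u] t v.
Proof.
move=> n2; set n : R := #|G|%:R.
have n1 : 1 < n by rewrite ltr1n.
set s := 1 - n^-1.
have n0 : 0 < n by lra.
have ni0 : 0 < n^-1 by rewrite invr_gt0.
have ni1 : n^-1 <= 1 by rewrite invf_le1// ltW.
have s01 : 0 <= s < 1 by rewrite /s; lra.
have /choice [g gE] : forall u, exists g : G -> R, forall x,
   g x - s * avg g x = (x == u)%:R.
  by move=> u; exact: resolvent_exists.
have g0 u x : 0 <= g u x.
  by apply: (resolvent_ge0 s01 (gE u)) => y; rewrite ler0n.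
have inner1 f u : inner f (fun x : G => (x == u)%:R : R) = deg R u * f u.
  rewrite /inner (bigD1 u)//= eqxx mulr1 big1 ?addr0// => x /negPf ->.
  by rewrite mulr0.
have g_sym u v : deg R v * g u v = deg R u * g v u.
  rewrite -!inner1.
  have -> : inner (g u) (fun x => (x == v)%:R) = inner (g u) (fun x => g v x + (- s) * avg (g v) x).
    by apply: eq_bigr => x _; rewrite -(gE v) mulNr.
  rewrite innerDr innerZr inner_avgC innerC [inner (avg _) _]innerC -innerZr -innerDr.
  by apply: eq_bigr => x _; rewrite -(gE u) mulNr.
have /card_gt0P [x0 _] : (0 < #|G|)%N by apply: ltn_trans n2.
have [v _ vmin] := @arg_minP _ _ _ x0 predT (fun v => g v v / deg R v) isT.
exists v => u t uv.
have du := deg_gt0 R deg_pos u; have dv := deg_gt0 R deg_pos v.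
have gu1 : 1 <= g u u.
  have := gE u u; rewrite eqxx => /eqP; rewrite subr_eq => /eqP ->.
  rewrite lerDl mulr_ge0//; first by case/andP: s01.
  by apply: sumr_ge0 => y _; rewrite mulr_ge0 ?step_prob_ge0.
have c0 : 0 < c by case/andP: c01.
have sn : (1 - s)^-1 = n by rewrite /s opprB addrC subrK invrK.
(* The mean part [n * deg u / vol] is at most [C], and the oscillation bound contributes [c^-1]. *)
have gle : g u u <= C + c^-1.
  have := resolvent_osc deg_pos s01 c01 gap (gE u) u.
  rewrite sn inner1 eqxx innerC inner1 !mulr1.
  set a := n * _ => H.
  have aC : a <= C.
    rewrite /a mulrA ler_pdivrMr ?(vol_gt0 R deg_pos u)//; exact: vol_ge.
  have {}H : (c * (g u u - a)) ^+ 2 <= 1.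
    by rewrite -(ler_pM2r du) mul1r exprMn mulrAC.
  have : c * (g u u - a) <= 1.
    rewrite leNgt; apply: contraTN H => lt1; rewrite -ltNge.
    by rewrite expr_gt1// ltW// (lt_trans ltr01).
  by rewrite mulrC -ler_pdivlMr// mul1r; lra.
pose e x : R := (x == u)%:R.
(* The potential of a unit current from [u] to [v] in the killed network; [wE] is its defining
   equation in weak form. *)
pose w x := (deg R u)^-1 * g u x + (- (deg R v)^-1) * g v x.
have wE f : inner f w - s * inner f (avg w) = f u - f v.
  transitivity (inner f (fun x => w x + (- s) * avg w x)).
    by rewrite [RHS]innerDr [X in _ = _ + X]innerZr mulNr.
  transitivity (inner f (fun x => (deg R u)^-1 * (x == u)%:R + (- (deg R v)^-1) * (x == v)%:R)).
    apply: eq_bigr => x _; congr (_ * _).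
    by rewrite /w avgD !avgZ -!gE; ring.
  rewrite innerDr !innerZr !inner1; field.
  by rewrite !gt_eqF.
have eu : e u = 1 by rewrite /e eqxx.
have ev : e v = 0 by rewrite /e eq_sym (negPf uv).
have ee : inner e e = deg R u by rewrite inner1 eu mulr1.
have eAe : inner e (avg e) = 0.
  rewrite innerC inner1 /avg (bigD1 u)//= step_probxx ?lt0n_neq0//.
  rewrite mul0r add0r big1 ?mulr0// => y /negPf yu.
  by rewrite /e yu mulr0.
(* Positivity of the form at [w - e / deg u] is the resistance bound [w u - w v >= 1 / deg u].
   Symmetry of [g] and the choice of [v] bound [w u - w v] by [2 * (g u u - g u v) / deg u]. *)
have key : g u v <= g u u - 2^-1.
  have := resolvent_form_ge0 (fun x => w x + (- (deg R u)^-1) * e x) (_ : 0 <= s <= 1).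
  rewrite resolvent_formD !wE ee eAe eu ev => H.
  have {}H := H (ltac:(by case/andP: s01 => ? /ltW ->; apply/andP)).
  have gvu : g v u / deg R v = g u v / deg R u.
    have du0 : deg R u != 0 by rewrite gt_eqF.
    have dv0 : deg R v != 0 by rewrite gt_eqF.
    by apply/eqP; rewrite eqr_div// mulrC -g_sym mulrC.
  have := vmin u isT; rewrite mulrC /w !mulNr ![_^-1 * _]mulrC gvu in H * => vm.
  have {}H : (deg R u)^-1 <= 2 * (g u u / deg R u - g u v / deg R u).
    have E : (- (deg R u)^-1) ^+ 2 * (deg R u - s * 0) = (deg R u)^-1 by field; rewrite gt_eqF.
    rewrite E in H; lra.
  have := ler_wpM2r (ltW du) H; rewrite mulVf ?gt_eqF//.
  have -> : 2 * (g u u / deg R u - g u v / deg R u) * deg R u = 2 * (g u u - g u v).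
    by field; rewrite gt_eqF.
  lra.
pose F y := (g u u)^-1 * g u y.
have gu0 : 0 < g u u by lra.
have Fle : F v <= 1 - 2 * (4 * (C + c^-1))^-1.
  rewrite /F mulrC ler_pdivrMr//.
  have K0 : 0 < C + c^-1 by lra.
  set K := C + c^-1 in gle K0 *.
  have -> : 1 - 2 * (4 * K)^-1 = 1 - (2 * K)^-1 by congr (_ - _); field; rewrite gt_eqF.
  rewrite mulrBl mul1r; apply: le_trans key _; rewrite lerD2l lerN2.
  by rewrite mulrC ler_pdivrMr; lra.
have H : s ^+ t * (1 - avoid [set u] t v) <= F v.
  apply: avoid_ge.
  - by case/andP: s01 => ? /ltW ->; apply/andP.
  - by move=> y; rewrite mulr_ge0// invr_ge0 ltW.
  - by rewrite /F mulVf// gt_eqF.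
  - move=> y yu; have := gE u y; rewrite (negPf yu) => /eqP; rewrite subr_eq0 => /eqP gy.
    by rewrite /F avgZ {1}gy mulrCA.
  - by rewrite eq_sym.
move=> tn; set K := C + c^-1 in gle Fle tn *.
have K1 : 1 <= K by lra.
have ti : t%:R / n <= (4 * K)^-1.
  by rewrite ler_pdivrMr// mulrC ler_pdivlMr//; lra.
(* Up to time [t] killing costs at most [k = 1 / (4 K)], half of the margin [2 k] in [Fle]. *)
have st : 1 - (4 * K)^-1 <= s ^+ t.
  apply: le_trans (bernoulli t _); last by apply/andP; split; lra.
  by lra.
have := avoid_le1 [set u] t v.
set A := avoid _ _ _ in H *.
have K4 : (4 * K)^-1 <= 4^-1 by rewrite lef_pV2 ?posrE; lra.
have K0 : 0 < (4 * K)^-1 by rewrite invr_gt0; lra.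
set k := (4 * K)^-1 in Fle ti st K4 K0 *.
move=> A1; have A0 : 0 <= A by exact: avoid_ge0.
have A1' : 0 <= 1 - A by lra.
have := ler_wpM2r A1' st.
have : 0 <= k * A by rewrite mulr_ge0// ltW.
lra.
Qed.
End Hitting.

(** * Comparison of schedules *)

Section Schedules.
Variables (R : realType) (G : sgraph) (I : finType).

(* Occupied vertices, and position of each particle that is not settled. *)
Definition state : Type := ({set G} * {ffun I -> option G})%type.
Implicit Types (s : state) (l : seq I) (r : I -> nat).

(** An occupied [y] leaves [s.1] unchanged under the union, so one formula covers both outcomes. *)
Definition move s i y : state :=
  (y |: s.1, [ffun j => if j == i then (if y \in s.1 then Some y else None)
                        else s.2 j])%SET.

Definition done s : bool := [forall i, s.2 i == None].

(* Expected value of phi after moving the particles of l in turn, where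
   settled particles do not move. *)
Fixpoint Ex l (phi : state -> R) s : R :=
  if l is i :: l' then
    if s.2 i is Some z then avg (fun y => Ex l' phi (move s i y)) z
    else Ex l' phi s
  else phi s.

Definition success l s : R := Ex l (fun s' => (done s')%:R) s.

Definition use r i : I -> nat := fun j => if j == i then (r j).-1 else r j.

(* Infimum, over all the strategies that choose the next particle to move, of
   the probability that all particles settle in at most m moves of which at
   most r i are moves of particle i. *)
Fixpoint worst m r s : R :=
  if done s then 1 else if m is m'.+1 then
    \big[Num.min/1]_(i | s.2 i != None)
      (if s.2 i is Some z then
         if r i is _.+1 then avg (fun y => worst m' (use r i) (move s i y)) z
         else 0
       else 0)
  else 0.

(** The term of index [i] in the minimum that defines [worst m.+1]. *)
Definition worst_move m r s i : R :=
  if s.2 i is Some z then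
    if r i is _.+1 then avg (fun y => worst m (use r i) (move s i y)) z
    else 0
  else 0.

Lemma avg_ge0 (f : G -> R) x : (forall y, 0 <= f y) -> 0 <= avg f x.
Proof. by move=> f0; rewrite -[leLHS](avg_cst _ x); apply: avg_le. Qed.

Lemma avg_le1 (f : G -> R) x : (forall y, f y <= 1) -> avg f x <= 1.
Proof. by move=> f0; rewrite -[leRHS](avg_cst _ x); apply: avg_le. Qed.

Lemma eq_avg (f h : G -> R) x : f =1 h -> avg f x = avg h x.
Proof. by move=> fh; apply: eq_bigr => y _; rewrite fh. Qed.

Lemma exchange_avg (f : G -> G -> R) x z :
  avg (fun y => avg (f y) z) x = avg (fun y' => avg (fun y => f y y') x) z.
Proof.
rewrite /avg; under eq_bigr do rewrite mulr_sumr; rewrite exchange_big.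
by apply: eq_bigr => y _; rewrite mulr_sumr; apply: eq_bigr => y' _; rewrite mulrCA.
Qed.

Lemma done_moveF s i y k : k != i -> s.2 k != None -> done (move s i y) = false.
Proof.
by move=> ki sk; apply/negbTE/forallPn; exists k; rewrite ffunE (negPf ki).
Qed.

Lemma not_done s i : s.2 i != None -> done s = false.
Proof. by move=> si; apply/negbTE/forallPn; exists i. Qed.

Lemma Ex_cat l1 l2 phi s : Ex (l1 ++ l2) phi s = Ex l1 (Ex l2 phi) s.
Proof.
elim: l1 s => [|i l1 IH] s //=; case: (s.2 i) => [z|]; last exact: IH.
by apply: eq_avg => y; exact: IH.
Qed.

Lemma Ex_le l phi psi s : (forall s', phi s' <= psi s') -> Ex l phi s <= Ex l psi s.
Proof.
move=> H; elim: l s => [|i l IH] s //=; case: (s.2 i) => [z|]; last exact: IH.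
by apply: avg_le => y; exact: IH.
Qed.

Lemma Ex_cst l a s : Ex l (fun=> a) s = a.
Proof.
elim: l s => [|i l IH] s //=; case: (s.2 i) => [z|]; last exact: IH.
by rewrite -[RHS](avg_cst _ z); apply: eq_avg.
Qed.

Lemma Ex_sum (J : Type) (js : seq J) l (phi : J -> state -> R) s :
  Ex l (fun s' => \sum_(j <- js) phi j s') s = \sum_(j <- js) Ex l (phi j) s.
Proof.
elim: l s => [|i l IH] s //=; case: (s.2 i) => [z|]; last exact: IH.
rewrite /avg exchange_big; apply: eq_bigr => y _; rewrite IH mulr_sumr//.
Qed.

Lemma ExD l phi psi s : Ex l (fun s' => phi s' + psi s') s = Ex l phi s + Ex l psi s.
Proof.
elim: l s => [|i l IH] s //=; case: (s.2 i) => [z|]; last exact: IH.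
by rewrite -avgD; apply: eq_avg => y; exact: IH.
Qed.

Lemma ExZ l a phi s : Ex l (fun s' => a * phi s') s = a * Ex l phi s.
Proof.
elim: l s => [|i l IH] s //=; case: (s.2 i) => [z|]; last exact: IH.
by rewrite -avgZ; apply: eq_avg => y; exact: IH.
Qed.

Lemma success_done l s : done s -> success l s = 1.
Proof.
rewrite /success; elim: l s => [|i l IH] s ds /=; first by rewrite ds.
by move/forallP/(_ i)/eqP: (ds) => ->; exact: IH.
Qed.

Lemma success_ge0 l s : 0 <= success l s.
Proof. by rewrite -[leLHS](Ex_cst l 0 s); apply: Ex_le => s'; rewrite ler0n. Qed.

Lemma worst01 m r s : 0 <= worst m r s <= 1.
Proof.
elim: m r s => [|m IH] r s /=; case: (done s); rewrite ?lexx ?ler01//.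
apply/andP; split.
  apply: le_bigmin => // i _; case: (s.2 i) => // z; case: (r i) => // _.
  by apply: avg_ge0 => y; case/andP: (IH (use r i) (move s i y)).
by apply: bigmin_le_id.
Qed.

Lemma worst_ge0 m r s : 0 <= worst m r s. Proof. by case/andP: (worst01 m r s). Qed.
Lemma worst_le1 m r s : worst m r s <= 1. Proof. by case/andP: (worst01 m r s). Qed.

Lemma worst_move_ge0 m r s i : 0 <= worst_move m r s i.
Proof.
rewrite /worst_move; case: (s.2 i) => // z; case: (r i) => // _.
by apply: avg_ge0 => y; exact: worst_ge0.
Qed.

Lemma worst_move_le1 m r s i : worst_move m r s i <= 1.
Proof.
rewrite /worst_move; case: (s.2 i) => // z; case: (r i) => // _.
by apply: avg_le1 => y; exact: worst_le1.
Qed.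

Lemma worst_le_move m r s i : s.2 i != None -> worst m.+1 r s <= worst_move m r s i.
Proof. by move=> si /=; rewrite (not_done si); apply: bigmin_le_cond. Qed.

(** A strategy may choose the particle that has no move left, which counts as failure. *)
Lemma worst_stuck m r s i : s.2 i != None -> r i = 0%N -> worst m r s = 0.
Proof.
case: m => [|m] si ri; first by rewrite /= (not_done si).
apply/eqP; rewrite eq_le worst_ge0 andbT.
by apply: le_trans (worst_le_move m r si) _; rewrite /worst_move ri; case: (s.2 i).
Qed.

(** Relabelling the particles by [p] changes nothing, and larger budgets can only help: the choice
    of [k] in one game is answered by [p k] in the other. *)
Lemma worst_dominated m (p : {perm I}) r r' s s' : s'.1 = s.1 ->
  (forall k, s'.2 (p k) = s.2 k) ->
  (forall k, s.2 k != None -> (r' (p k) <= r k)%N) ->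
  worst m r' s' <= worst m r s.
Proof.
elim: m r r' s s' => [|m IH] r r' s s' s1 s2 rr.
  have -> : worst 0 r' s' = worst 0 r s; last by [].
  rewrite /=; suff -> : done s' = done s by [].
  apply/forallP/forallP => H k; first by rewrite -s2.
  by rewrite -(permKV p k) s2.
have [ds|ds] := boolP (done s); first by rewrite {2}/worst ds worst_le1.
rewrite [leRHS]/= (negPf ds); apply: le_bigmin => [|k sk]; first exact: worst_le1.
apply: le_trans (worst_le_move _ _ (_ : s'.2 (p k) != None)) _; first by rewrite s2.
rewrite -/(worst_move m r s k) /worst_move s2; case E : (s.2 k) sk => [z|] // sk.
have := rr k; rewrite E => /(_ isT).
case E' : (r' (p k)) => [|a'].
  by move=> _; case: (r k) => // _; apply: avg_ge0 => y; exact: worst_ge0.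
case E'' : (r k) => [|a] // aa; apply: avg_le => y; apply: IH => /=.
- by rewrite s1.
- by move=> j; rewrite !ffunE (inj_eq perm_inj) s1 s2.
- move=> j; rewrite !ffunE /use (inj_eq perm_inj).
  by have [->|_ /rr //] := eqVneq j k; rewrite E' E''.
Qed.

(* Moving first a particle i and then a particle j, or j and then i, only
   matters when both step to the same vacant vertex; having the particle with
   more moves left continue is then better. *)
Lemma worst_move_youngest m r s j i : s.2 j != None ->
  (forall k, s.2 k != None -> (r k <= r j)%N) -> s.2 i != None ->
  worst_move m r s j <= worst_move m r s i.
Proof.
elim: m r s j i => [|m IH] r s j i sj rj si.
  have [-> //|ij] := eqVneq i j.
  rewrite {1}/worst_move; case: (s.2 j) => [z|]; last exact: worst_move_ge0.
  case: (r j) => [|a]; first exact: worst_move_ge0.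
  rewrite [X in X <= _](_ : _ = 0) ?worst_move_ge0//.
  rewrite -[RHS](avg_cst _ z); apply: eq_avg => y /=.
  by rewrite (done_moveF _ ij).
have [-> //|ij] := eqVneq i j.
case Ei : (s.2 i) (si) => [zi|] // _; case Ej : (s.2 j) (sj) => [zj|] // _.
have ji : j != i by rewrite eq_sym.
case Ri : (r i) => [|a].
  rewrite {1}/worst_move Ej; case: (r j) => [|b]; first exact: worst_move_ge0.
  rewrite [X in X <= _](_ : _ = 0) ?worst_move_ge0//.
  rewrite -[RHS](avg_cst _ zj); apply: eq_avg => y; apply: (@worst_stuck _ _ _ i).
    by rewrite ffunE (negPf ij).
  by rewrite /use (negPf ij).
have := rj i si; rewrite Ri; case Rj : (r j) => [|b] // ab.
(* After the move of [i], [j] still has the most moves left, so by induction [j] is a worst choice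
   for the next move. *)
have after_i y : worst_move m (use r i) (move s i y) j <= worst m.+1 (use r i) (move s i y).
  have jact : (move s i y).2 j != None by rewrite ffunE (negPf ji).
  rewrite [leRHS]/= (not_done jact).
  apply: le_bigmin => [|k kact]; first exact: worst_move_le1.
  apply: IH => // k'; rewrite ffunE /use (negPf ji).
  have [->|_] := eqVneq k' i.
    by rewrite Ri Rj => _; apply: leq_trans ab; rewrite leqnSn.
  exact: rj.
(* After the move of [j], moving [i] is one of the available choices. *)
have after_j z : worst m.+1 (use r j) (move s j z) <= worst_move m (use r j) (move s j z) i.
  by apply: worst_le_move; rewrite ffunE (negPf ij).
rewrite [leLHS]/worst_move [leRHS]/worst_move Ei Ej Ri Rj.
apply: (@le_trans _ _ (avg (fun z => worst_move m (use r j) (move s j z) i) zj)).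
  by apply: avg_le => z; exact: after_j.
apply: (@le_trans _ _ (avg (fun y => worst_move m (use r i) (move s i y) j) zi)); last first.
  by apply: avg_le => y; exact: after_i.
have -> : avg (fun z => worst_move m (use r j) (move s j z) i) zj =
   avg (fun z => avg (fun y => worst m (use (use r j) i) (move (move s j z) i y)) zi) zj.
  by apply: eq_avg => z; rewrite /worst_move ffunE (negPf ij) Ei /use (negPf ij) Ri.
have -> : avg (fun y => worst_move m (use r i) (move s i y) j) zi =
   avg (fun y => avg (fun z => worst m (use (use r i) j) (move (move s i y) j z)) zj) zi.
  by apply: eq_avg => y; rewrite /worst_move ffunE (negPf ji) Ej /use (negPf ji) Rj.
rewrite [leRHS]exchange_avg; apply: avg_le => z; apply: avg_le => y.
have use_le k : (use (use r j) i k <= use (use r i) j k)%N.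
  by rewrite /use; case: (k == i); case: (k == j).
(* Both step to the same vacant vertex: the first one settles and the other goes on. Exchanging the
   two labels compares [i] with [a] moves left to [j] with [b >= a] moves left. *)
have [yz|yz] := boolP ((y == z) && (y \notin s.1)).
  move: yz => /andP[/eqP<- ys].
  apply: (@worst_dominated m (tperm i j)) => /=.
  - by [].
  - move=> k; rewrite !ffunE !in_setU1 eqxx /= (negPf ys).
    case: tpermP => [->|->|/eqP/negPf ki /eqP/negPf kj].
    + by rewrite eqxx (negPf ji) (negPf ij) eqxx.
    + by rewrite !eqxx.
    + by rewrite ki kj.
  - move=> k; rewrite !ffunE !in_setU1 eqxx /= (negPf ys) /use.
    case: tpermP => [->|->|/eqP/negPf ki /eqP/negPf kj].
    + by rewrite (negPf ij) eqxx.
    + by rewrite !eqxx (negPf ij) (negPf ji) Ri Rj.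
    + by rewrite ki kj.
(* In all other cases the two orders lead to the same state. *)
apply: (@worst_dominated m 1%g) => /=.
- by rewrite finset.setUCA.
- move=> k; rewrite perm1 !ffunE !in_setU1.
  have [->|ki] := eqVneq k i.
    rewrite (negPf ij); move: yz; rewrite negb_and negbK.
    by case: (y == z) => //= ->.
  have [_|//] := eqVneq k j; move: yz; rewrite negb_and negbK (eq_sym z).
  by case: eqP => //= -> ->.
- by move=> k; rewrite perm1.
Qed.

(** At each turn the particle on turn has the most turns left in the list, the current one
    included. *)
Fixpoint balanced l : Prop :=
  if l is j :: l' then (forall k, count_mem k l <= count_mem j l)%N /\ balanced l'
  else True.

(** By [worst_move_youngest] each turn of a balanced list is a minimising choice. *)
Lemma success_le_worst l m r s : balanced l ->
  (forall i, s.2 i != None -> r i = count_mem i l) -> (size l <= m)%N ->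
  success l s <= worst m r s.
Proof.
rewrite /success; elim: l m r s => [|j l IH] m r s /= bl rl lm.
  by case E : (done s); [case: m {lm} => [|m] /=; rewrite E | rewrite worst_ge0].
case: bl => bj bl; case Ej : (s.2 j) => [z|]; last first.
  apply: IH (ltnW lm) => // i si; rewrite rl//.
  by case: eqP => // ij; move: si; rewrite -ij Ej.
case: m lm => // m lm; have sj : s.2 j != None by rewrite Ej.
apply: (@le_trans _ _ (worst_move m r s j)).
  rewrite /worst_move Ej rl// eqxx add1n; apply: avg_le => y.
  apply: IH => // i; rewrite ffunE /use; case: (eqVneq i j) => [->|ij].
    by rewrite rl// eqxx.
  by move=> si; rewrite rl// eq_sym (negPf ij).
rewrite [leRHS]/= (not_done sj); apply: le_bigmin => [|k sk].
  exact: worst_move_le1.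
by apply: worst_move_youngest => // k' sk'; rewrite !rl.
Qed.

(** The list is itself one of the strategies over which the infimum is taken, and it grants at least
    the budget [r]. *)
Lemma worst_le_success l m r s : (forall i, s.2 i != None -> (r i <= count_mem i l)%N) ->
  worst m r s <= success l s.
Proof.
rewrite /success; elim: l m r s => [|j l IH] m r s /= rl.
  have [ds|/forallPn[i si]] := boolP (done s); first exact: worst_le1.
  by rewrite (worst_stuck _ si)//; apply/eqP; rewrite -leqn0; exact: rl.
case Ej : (s.2 j) => [z|]; last first.
  apply: IH => // i si; apply: leq_trans (rl i si) _.
  by case: eqP => // ij; move: si; rewrite -ij Ej.
have sj : s.2 j != None by rewrite Ej.
case: m => [|m].
  by rewrite /= (not_done sj); apply: avg_ge0 => y; exact: success_ge0.
apply: le_trans (worst_le_move m r sj) _; rewrite /worst_move Ej.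
case Rj : (r j) => [|a]; first by apply: avg_ge0 => y; exact: success_ge0.
apply: avg_le => y; apply: IH => i; rewrite ffunE /use; case: (eqVneq i j) => [->|ij].
  by have := rl j sj; rewrite eqxx Rj.
by move=> si; apply: leq_trans (rl i si) _; rewrite eq_sym (negPf ij).
Qed.

Lemma balanced_success_le l l' s : balanced l ->
  (forall i, count_mem i l <= count_mem i l')%N -> success l s <= success l' s.
Proof.
move=> bl ll; have H : success l s <= worst (size l) (fun i => count_mem i l) s.
  exact: success_le_worst.
by apply: le_trans H _; apply: worst_le_success => i _; exact: ll.
Qed.

End Schedules.

(** * The parallel process after a window of rounds *)

Section Bounds.
Variables (R : realType) (G : sgraph) (I : finType).
Local Notation state := (state G I).
Implicit Types (s : state) (l : seq I).

(** The parallel schedule. Moving in index order within a round gives a contested vertex to the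
    particle of smallest index. *)
Definition rounds t : seq I := flatten (nseq t (enum I)).
Definition one_by_one t : seq I := flatten [seq nseq t i | i <- enum I].

Lemma count_enum (i : I) : count_mem i (enum I) = 1%N.
Proof. by rewrite count_uniq_mem ?enum_uniq// mem_enum. Qed.

Lemma rounds_add a b : rounds (a + b) = rounds a ++ rounds b.
Proof. by rewrite /rounds nseqD flatten_cat. Qed.

Lemma count_rounds t i : count_mem i (rounds t) = t.
Proof.
elim: t => [|t IH] //; rewrite /rounds /= count_cat count_enum -/(rounds t) IH.
by rewrite add1n.
Qed.

Lemma count_one_by_one t i : count_mem i (one_by_one t) = t.
Proof.
have H (e : seq I) : uniq e ->
    count_mem i (flatten [seq nseq t j | j <- e]) = ((i \in e) * t)%N.
  elim: e => [|j e IH] //= /andP[je ue].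
  rewrite count_cat IH// count_nseq in_cons; have [<-|ji] := eqVneq j i.
    by rewrite /= eqxx (negPf je) mul0n addn0.
  by rewrite -[pred1 i j]/(j == i) (negPf ji).
by rewrite /one_by_one H ?enum_uniq// mem_enum mul1n.
Qed.

Lemma balanced_cat (e l : seq I) t : uniq e -> (forall k, count_mem k l = t) ->
  balanced l -> balanced (e ++ l).
Proof.
move=> + lt bl; elim: e => [|j e IH] //= /andP[je ue]; split; last exact: IH.
move=> k; rewrite !count_cat !lt !count_uniq_mem// eqxx (negPf je) add0n addnA.
rewrite leq_add2r; case: eqP => [<-|_]; first by rewrite (negPf je).
by rewrite add0n leq_b1.
Qed.

Lemma balanced_rounds t : balanced (rounds t).
Proof.
elim: t => [|t IH] //; rewrite /rounds /=.
by apply: (balanced_cat _ (count_rounds t)) => //; exact: enum_uniq.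
Qed.

Lemma rounds_le_one_by_one t s :
  success R (rounds t) s <= success R (one_by_one t) s.
Proof.
apply: balanced_success_le; first exact: balanced_rounds.
by move=> i; rewrite count_rounds count_one_by_one.
Qed.

Definition active s : {set I} := [set i | s.2 i != None]%SET.

Lemma in_active s i : (i \in active s) = (s.2 i != None).
Proof. by rewrite inE. Qed.

Lemma done_active s : done s = (#|active s| == 0%N).
Proof.
rewrite cards_eq0; apply/forallP/eqP => [H|H i].
  by apply/setP => i; rewrite in_active H finset.in_set0.
by have := in_active s i; rewrite H finset.in_set0 => /esym/negbFE.
Qed.

Lemma active_move s i y : s.2 i != None ->
  active (move s i y) = if y \in s.1 then active s else (active s :\ i)%SET.
Proof.
move=> si; apply/setP => k; rewrite in_active ffunE.
by case: (y \in s.1); rewrite ?in_setD1 in_active; have [->|] := eqVneq k i; rewrite ?si.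
Qed.

Lemma card_move s i y : s.2 i != None ->
  (#|(move s i y).1| + #|active (move s i y)| = #|s.1| + #|active s|)%N.
Proof.
move=> si; rewrite active_move//= cardsU1; case: ifP => ys //=.
rewrite add1n addSn -addnS; congr (_ + _)%N.
by rewrite (cardsD1 i (active s)) in_active si.
Qed.

(** Each settlement uses up one vacant vertex and one active particle, so their numbers stay
    equal. *)
Definition wf s := (#|s.1| + #|active s| == #|G|)%N &&
  [forall i, if s.2 i is Some z then z \in s.1 else true].

Lemma wf_move s i y : s.2 i != None -> wf s -> wf (move s i y).
Proof.
move=> si /andP[cs /forallP ps]; apply/andP; split; first by rewrite card_move.
apply/forallP => k; rewrite ffunE; have [_|_] := eqVneq k i.
  by case: ifP => // ys; rewrite /= in_setU1 eqxx.
by have := ps k; case: (s.2 k) => // z zs; rewrite /= in_setU1 zs orbT.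
Qed.

Lemma Ex_le_inv (inv : state -> Prop) l (phi psi : state -> R) s :
  (forall s i y, s.2 i != None -> inv s -> inv (move s i y)) ->
  (forall s', inv s' -> phi s' <= psi s') -> inv s -> Ex l phi s <= Ex l psi s.
Proof.
move=> inv_move H; elim: l s => [|i l IH] s /= si; first exact: H.
case E : (s.2 i) => [z|]; last exact: IH.
by apply: avg_le => y; apply: IH; apply: inv_move => //; rewrite E.
Qed.

Lemma success_absent l s k : s.2 k != None -> k \notin l -> success R l s = 0.
Proof.
elim: l s => [|i l IH] s sk; first by rewrite /success /= (not_done sk).
rewrite inE negb_or => /andP[ki kl]; rewrite /success /=.
case E : (s.2 i) => [z|]; last exact: IH.
rewrite -[RHS](avg_cst _ z); apply: eq_avg => y; apply: IH => //.
by rewrite ffunE (negPf ki).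
Qed.

Lemma success_le1 l s : success R l s <= 1.
Proof.
rewrite -[leRHS](Ex_cst l 1 s); apply: Ex_le => s'.
by case: (done s'); rewrite ?lexx ?ler01.
Qed.

(** With [u] the only vacant vertex, the occupied set is constant until the walk hits [u]. *)
Lemma success_single t s k u z : s.1 = (~: [set u])%SET -> s.2 k = Some z ->
  z != u -> success R (nseq t k) s <= 1 - avoid R [set u] t z.
Proof.
elim: t s z => [|t IH] s z s1 sk zu.
  by rewrite /success /= subrr (@not_done _ _ _ k)// sk.
rewrite /success /= sk.
set h := fun y => if _ then _ else _.
have -> : 1 - avg h z = avg (fun y => 1 + (-1) * h y) z.
  by rewrite [RHS]avgD avg_cst [X in _ = _ + X]avgZ mulN1r.
apply: avg_le => y; rewrite /h mulN1r finset.in_set1; have [_|yu] := eqVneq y u.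
  by rewrite subr0 success_le1.
have ys : y \in s.1 by rewrite s1 !inE.
apply: IH => //=; first by rewrite -s1; apply/finset.setUidPr; rewrite finset.sub1set.
by rewrite ffunE eqxx ys.
Qed.

(** The moves in [e] do not involve [k]; they only decide which vertex [u] is left vacant. It
    differs from the occupied [v], and [k] has to hit it from [v]. *)
Lemma success_last (e : seq I) t s k v (eps : R) : wf s -> s.2 k = Some v ->
  k \notin e -> eps <= 1 ->
  (forall u, u != v -> eps <= avoid R [set u] t v) ->
  success R (e ++ nseq t k) s <= 1 - eps.
Proof.
move=> ws sk ke eps1 H; elim: e s ws sk ke => [|i e IH] s ws sk ke.
  (* Another particle still active would have no turn left. *)
  have [/existsP[j /andP[sj jk]]|] := boolP [exists j, (s.2 j != None) && (j != k)].
    rewrite (success_absent sj) ?subr_ge0//=.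
    by apply/negP => /nseqP[jk']; rewrite jk' eqxx in jk.
  rewrite negb_exists => /forallP only.
  have act : active s = [set k]%SET.
    apply/setP => j; rewrite in_active finset.in_set1; have := only j.
    by have [->|] := eqVneq j k; rewrite ?sk// andbT negbK => _ /eqP ->.
  case/andP: ws; rewrite act cards1 => /eqP cs /forallP/(_ k); rewrite sk => vs.
  have : #|(~: s.1)%SET| = 1%N by apply/eqP; rewrite -(eqn_add2l #|s.1|) cardsC cs.
  move/eqP/cards1P => [u su].
  have s1 : s.1 = (~: [set u])%SET by rewrite -su finset.setCK.
  have vu : v != u by move: vs; rewrite s1 !inE.
  apply: le_trans (success_single t s1 sk vu) _.
  by rewrite lerD2l lerN2 H// eq_sym.
move: ke; rewrite inE negb_or => /andP[ki ke]; rewrite /success /=.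
case E : (s.2 i) => [z|]; last exact: IH.
rewrite -[leRHS](avg_cst _ z); apply: avg_le => y; apply: IH => //.
  by apply: wf_move => //; rewrite E.
by rewrite ffunE (negPf ki).
Qed.

Definition missed (J : {set I}) (S : {set G}) s : bool :=
  (J \subset active s) && [disjoint S & s.1].

Lemma missed_move J S s i y : s.2 i != None ->
  missed J S (move s i y) -> missed J S s.
Proof.
move=> si /andP[Ja Sd]; apply/andP; split.
  apply: fintype.subset_trans Ja _; rewrite active_move//.
  by case: ifP => // _; rewrite subD1set.
by apply: disjointWr Sd; apply/fintype.subsetP => z zs; rewrite /= in_setU1 zs orbT.
Qed.

Lemma Ex_missed0 J S l s : ~~ missed J S s ->
  Ex l (fun s' => (missed J S s')%:R) s = 0 :> R.
Proof.
elim: l s => [|i l IH] s ms /=; first by rewrite (negPf ms).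
case E : (s.2 i) => [z|]; last exact: IH.
rewrite -[RHS](avg_cst _ z); apply: eq_avg => y; apply: IH.
by apply: contra ms; apply: missed_move; rewrite E.
Qed.

(** Every particle of [J] has to avoid [S] in all its moves, and the moves of different particles
    are independent. *)
Lemma Ex_missed J S l s :
  Ex l (fun s' => (missed J S s')%:R) s <=
  \prod_(i in J) (if s.2 i is Some z then avoid R S (count_mem i l) z else 1).
Proof.
have term_ge0 (s' : state) c i :
    0 <= if s'.2 i is Some z then avoid R S c z else 1.
  by case: (s'.2 i) => // z; exact: avoid_ge0.
elim: l s => [|i l IH] s /=.
  by rewrite big1 ?lern1 ?leq_b1// => i _; case: (s.2 i).
case E : (s.2 i) => [z|]; last first.
  apply: le_trans (IH s) _; rewrite le_eqVlt; apply/orP; left; apply/eqP.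
  apply: eq_bigr => j _; case E' : (s.2 j) => [z|] //.
  by have [ij|//] := eqVneq i j; rewrite ij E' in E.
have [iJ|iJ] := boolP (i \in J); last first.
  rewrite -[leRHS](avg_cst _ z); apply: avg_le => y; apply: le_trans (IH _) _.
  rewrite le_eqVlt; apply/orP; left; apply/eqP; apply: eq_bigr => j jJ.
  have ji : j != i by apply: contraNneq iJ => <-.
  by rewrite ffunE (negPf ji) [i == j]eq_sym (negPf ji).
rewrite (bigD1 i)//= E eqxx add1n /=.
set P := \prod_(j in J | _) _.
have P0 : 0 <= P by apply: prodr_ge0 => j _; exact: term_ge0.
rewrite mulrC -avgZ; apply: avg_le => y.
have [ys|ys] := boolP (y \in S).
  rewrite mulr0 Ex_missed0//; apply/negP => /andP[_].
  by rewrite disjoint_sym => /disjointFr/(_ (setU11 _ _)); rewrite ys.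
have [m|m] := boolP (missed J S (move s i y)); last first.
  by rewrite Ex_missed0// mulr_ge0 ?avoid_ge0.
apply: le_trans (IH _) _; rewrite (bigD1 i)//= mulrC; apply: ler_pM => //.
- by apply: prodr_ge0 => j _; exact: (term_ge0 (move s i y)).
- exact: (term_ge0 (move s i y)).
- rewrite le_eqVlt; apply/orP; left; apply/eqP; apply: eq_bigr => j /andP[_ ji].
  by rewrite ffunE (negPf ji) [i == j]eq_sym (negPf ji).
rewrite ffunE eqxx; case: ifP => // ys1.
(* On a vacant [y] the particle [i] would settle, contrary to [missed]. *)
case/andP: m => /fintype.subsetP/(_ i iJ); rewrite in_active ffunE eqxx ys1 eqxx//.
Qed.


Lemma subset_of_card (T : finType) (A : {set T}) h : (h <= #|A|)%N ->
  exists2 B : {set T}, B \subset A & #|B| = h.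
Proof.
move=> /card_geqP [r [ur sr rA]]; exists [set x in r]%SET.
  by apply/fintype.subsetP => x; rewrite inE => /rA.
by rewrite cardsE -sr; apply/card_uniqP.
Qed.

(* Union bound over the particles that are still active and the vertices that
   are still vacant at the end. *)
Lemma Ex_many_active h l s : wf s -> (#|active s| < 2 * h)%N ->
  (forall (S : {set G}) i z, #|S| = h -> z \notin S -> avoid R S (count_mem i l) z <= 32^-1) ->
  Ex l (fun s' => (h <= #|active s'|)%N%:R) s <= 2^-1 :> R.
Proof.
move=> ws sh H.
have h0 : (0 < h)%N by rewrite lt0n; apply: contraTneq sh => ->; rewrite muln0.
pose JJ := [seq J : {set I} <- enum (powerset (active s)) | #|J| == h].
pose SS := [seq S : {set G} <- enum (powerset (~: s.1)%SET) | #|S| == h].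
pose inv (s' : state) := [/\ wf s', active s' \subset active s & s.1 \subset s'.1].
apply: (@le_trans _ _ (Ex l (fun s' => \sum_(J <- JJ) \sum_(S <- SS) (missed J S s')%:R) s)).
  apply: (@Ex_le_inv inv) => [s' i y si [ws' sa ss]|s' [ws' sa ss]|//]; last first.
    have term0 J S : 0 <= (missed J S s')%:R :> R by rewrite ler0n.
    have [hs'|_] := leqP h #|active s'|; last by rewrite !sumr_ge0// => J _; apply: sumr_ge0.
    have [J Ja Jh] := subset_of_card hs'.
    have cardC : #|(~: s'.1)%SET| = #|active s'|.
      by apply/eqP; rewrite -(eqn_add2l #|s'.1|) cardsC eq_sym; case/andP: ws'.
    have [S Sa Sh] : exists2 S : {set G}, S \subset (~: s'.1)%SET & #|S| = h.
      by apply: subset_of_card; rewrite cardC.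
    have JJJ : J \in JJ.
      by rewrite mem_filter Jh eqxx mem_enum powersetE (fintype.subset_trans Ja sa).
    have SSS : S \in SS.
      rewrite mem_filter Sh eqxx mem_enum powersetE (fintype.subset_trans Sa)//.
      by rewrite finset.setCS.
    have mis : missed J S s' by rewrite /missed Ja finset.disjoints_subset.
    rewrite (big_rem J)//= (big_rem S)//= mis -addrA lerDl addr_ge0//.
      by apply: sumr_ge0 => S' _.
    by apply: sumr_ge0 => J' _; apply: sumr_ge0 => S' _.
  split; first exact: wf_move.
    apply: fintype.subset_trans sa; rewrite active_move//.
    by case: ifP => // _; rewrite subD1set.
  by apply: (fintype.subset_trans ss); rewrite finset.subsetU1.
rewrite Ex_sum.
apply: (@le_trans _ _ (\sum_(J <- JJ) \sum_(S <- SS) (32^-1) ^+ h)).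
  rewrite [leLHS]big_seq [leRHS]big_seq; apply: ler_sum => J.
  rewrite mem_filter => /andP[/eqP Jh _]; rewrite Ex_sum.
  rewrite [leLHS]big_seq [leRHS]big_seq; apply: ler_sum => S.
  rewrite mem_filter => /andP[/eqP Sh _].
  have [m|m] := boolP (missed J S s); last by rewrite Ex_missed0// exprn_ge0// invr_ge0.
  apply: le_trans (Ex_missed _ _ _ _) _; rewrite -Jh -prodr_const.
  case/andP: m => /fintype.subsetP Ja Sd.
  apply: ler_prod => i iJ; have := Ja i iJ; rewrite in_active.
  case E : (s.2 i) => [z|] // _; rewrite avoid_ge0 H//.
  case/andP: ws => _ /forallP/(_ i); rewrite E => zs.
  by rewrite disjoint_sym in Sd; rewrite (disjointFr Sd zs).
have size_le (T : finType) (A : {set T}) : (#|A| < 2 * h)%N ->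
    (size [seq B : {set T} <- enum (powerset A) | #|B| == h])%:R <= 4 ^+ h :> R.
  move=> Ah; apply: (@le_trans _ _ (2 ^ #|A|)%N%:R).
    by rewrite ler_nat -card_powerset cardE size_filter count_size.
  have -> : 4 ^+ h = (2 ^ (2 * h))%N%:R :> R by rewrite expnM natrX.
  by rewrite ler_nat leq_exp2l// ltnW.
have J4 := size_le _ _ sh; have S4 : (size SS)%:R <= 4 ^+ h :> R.
  apply: size_le; suff -> : #|(~: s.1)%SET| = #|active s| by [].
  by apply/eqP; rewrite -(eqn_add2l #|s.1|) cardsC eq_sym; case/andP: ws.
have sumc (T : Type) (r : seq T) (a : R) : \sum_(x <- r) a = (size r)%:R * a.
  by rewrite big_const_seq count_predT iter_addr_0 mulr_natl.
rewrite !sumc.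
(* At most [4 ^+ h] sets of each kind occur, and 4 * 4 / 32 = 1/2. *)
apply: (@le_trans _ _ (4 ^+ h * (4 ^+ h * 32^-1 ^+ h))).
  by apply: ler_pM => //; rewrite ler_wpM2r// exprn_ge0// invr_ge0.
rewrite -!exprMn (_ : 4 * (4 * 32^-1) = 2^-1); last by field.
by rewrite -[leRHS]expr1 ler_wiXn2l ?invr_ge0 ?invf_le1// ler1n.
Qed.

Definition fail t s : R := 1 - success R (rounds t) s.

Lemma fail_le1 t s : fail t s <= 1.
Proof. by rewrite lerBlDr lerDl success_ge0. Qed.

Lemma fail_ge0 t s : 0 <= fail t s.
Proof. by rewrite subr_ge0 success_le1. Qed.

Lemma fail_add a b s : fail (a + b) s = Ex (rounds a) (fail b) s.
Proof.
rewrite /fail /success rounds_add Ex_cat.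
set f := Ex (rounds b) _.
transitivity (Ex (rounds a) (fun s' => 1 + (-1) * f s') s); last first.
  by congr (Ex _ _ _); apply/funext => s'; rewrite mulN1r.
by rewrite ExD Ex_cst ExZ mulN1r.
Qed.

(** A partial sum of the tail series of the mean parallel dispersion time from [s]. *)
Definition fails N s : R := \sum_(t < N) fail t s.

Lemma fails_window L N s : fails N s <= L%:R + Ex (rounds L) (fails N) s.
Proof.
apply: (@le_trans _ _ (\sum_(t < L + N) fail t s)).
  rewrite addnC big_split_ord /= lerDl; apply: sumr_ge0 => t _; exact: fail_ge0.
rewrite big_split_ord /=; apply: lerD.
  apply: (@le_trans _ _ (\sum_(t < L) 1)); last by rewrite sumr_const card_ord.
  by apply: ler_sum => t _; exact: fail_le1.
rewrite /fails Ex_sum; apply: ler_sum => t _.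
by rewrite -fail_add.
Qed.

Lemma fails_done N s : done s -> fails N s = 0.
Proof.
by move=> ds; apply: big1 => t _; rewrite /fail success_done// subrr.
Qed.

(** For the maximum [a] of [fails N] over the states with fewer than [2 * h] active particles, one
    window gives [a <= L + a / 2 + b / 2]. The sum is truncated at [N] and the states are finitely
    many, so [a] is finite. *)
Lemma fails_halving h L N b : (0 < h)%N -> 0 <= b ->
  (forall s, wf s -> (#|active s| < h)%N -> fails N s <= b) ->
  (forall s, wf s -> (#|active s| < 2 * h)%N ->
     Ex (rounds L) (fun s' => (h <= #|active s'|)%N%:R) s <= 2^-1 :> R) ->
  forall s, wf s -> (#|active s| < 2 * h)%N -> fails N s <= 2 * L%:R + b.
Proof.
move=> h0 b0 Hb Hp.
pose P s := wf s && (#|active s| < 2 * h)%N.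
pose a := \big[Num.max/0]_(s | P s) fails N s.
suff ab : a <= 2 * L%:R + b.
  move=> s ws sh; apply: le_trans ab; apply: le_bigmax_cond.
  by rewrite /P ws sh.
have [ab|/ltW ba] := leP a b.
  by apply: le_trans ab _; rewrite lerDr mulr_ge0.
suff : a <= L%:R + 2^-1 * a + 2^-1 * b by lra.
apply: bigmax_le => [|s /andP[ws sh]].
  by have := ler0n R L; lra.
apply: le_trans (fails_window L N s) _; rewrite -addrA lerD2l.
pose inv s' := wf s' /\ (#|active s'| < 2 * h)%N.
apply: (@le_trans _ _ (Ex (rounds L)
   (fun s' => b + (a - b) * (h <= #|active s'|)%N%:R) s)).
  apply: (@Ex_le_inv inv) => //.
    move=> s' i y si [ws' sh']; split; first exact: wf_move.
    apply: leq_ltn_trans sh'; rewrite active_move//.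
    by case: ifP => // _; rewrite subset_leq_card// subD1set.
  move=> s' [ws' sh']; case: leqP => hs'.
    rewrite mulr1 addrC subrK; apply: le_bigmax_cond.
    by rewrite /P ws' sh'.
  by rewrite mulr0 addr0; exact: Hb.
rewrite ExD Ex_cst ExZ; have := Hp s ws sh.
set p := Ex _ _ _ => p2.
have : (a - b) * p <= (a - b) * 2^-1 by rewrite ler_wpM2l// subr_ge0.
lra.
Qed.

End Bounds.

(** * Summation over the dyadic numbers of active particles *)

Section ParallelBound.
Variables (R : realType) (G : sgraph) (I : finType) (c C : R).
Hypotheses (deg_pos : forall x : G, (0 < degree x)%N) (c01 : 0 < c <= 1)
  (gap : forall f : G -> R, inner f (fun=> 1) = 0 ->
           inner f (avg f) <= (1 - c) * inner f f)
  (deg_le : forall x y : G, deg R x <= C * deg R y) (C1 : 1 <= C).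

(* A set of 2 ^ j vertices is hit within O(n (3 / 4) ^ j) steps, because
   (3 / 4) ^ j >= 2 ^ (- j / 2); these times are summable in j. *)
Lemma fails_bound N (s : state G I) : (0 < #|G|)%N -> wf s ->
  fails R N s <= 4 * (128 * (128 * (C / c) * #|G|%:R)).
Proof.
move=> G0 ws; case/andP: (c01) => c0 c1.
set n : R := #|G|%:R; have n0 : 0 < n by rewrite ltr0n.
pose K := 128 * (C / c).
have Cc : 1 <= C / c by rewrite ler_pdivlMr// mul1r (le_trans c1).
have K1 : 1 <= K by rewrite /K; lra.
pose T j : R := K * n * (3 / 4) ^+ j.
pose D := 128 * (K * n).
(* Partial sums of the geometric series with terms [D * (3 / 4) ^+ i = 128 * T i], each paying for
   twice a window of at most [64 * T i] rounds. *)
pose B j : R := 4 * D * (1 - (3 / 4) ^+ j).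
have p01 j : 0 <= (3 / 4 : R) ^+ j <= 1.
  by apply/andP; split; [apply: exprn_ge0|apply: exprn_ile1]; lra.
have Kn : 0 <= K * n by rewrite mulr_ge0 ?ltW//; lra.
have D0 : 0 <= D by rewrite mulr_ge0.
have B0 j : 0 <= B j.
  rewrite mulr_ge0//; first by rewrite mulr_ge0.
  by case/andP: (p01 j) => _; rewrite subr_ge0.
have claim J : (forall j, (j < J)%N -> (2 ^ j <= #|G|)%N) ->
   forall s' : state G I, wf s' -> (#|active s'| < 2 ^ J)%N -> fails R N s' <= B J.
  elim: J => [|j IH] Hj s' ws' sj.
    rewrite fails_done// done_active; by move: sj; rewrite expn0 ltnS leqn0.
  have jn := Hj j (ltnSn j).
  have {}IH : forall s' : state G I, wf s' -> (#|active s'| < 2 ^ j)%N -> fails R N s' <= B j.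
    by apply: IH => i ij; apply: Hj; rewrite ltnS ltnW.
  (* Since [2 ^ j <= #|G|] and 2 * 3/4 is at least 1. *)
  have T1 : 1 <= T j.
    have : 1 <= n * (3 / 4) ^+ j.
      apply: (@le_trans _ _ ((2 ^ j)%N%:R * (3 / 4) ^+ j)).
        rewrite natrX -exprMn; apply: exprn_ege1; lra.
      by rewrite ler_wpM2r ?ler_nat//; case/andP: (p01 j).
    move=> H; rewrite /T -mulrA -[leLHS]mulr1; apply: ler_pM => //; exact: ler01.
  pose L := (Num.truncn (63 * T j)).+1.
  have LT : 63 * T j <= L%:R by apply/ltW/truncnS_gt.
  have LT' : L%:R <= 64 * T j.
    rewrite /L -natr1; have := truncn_le (63 * T j); lra.
  have avoidL (S : {set G}) z : #|S| = (2 ^ j)%N -> z \notin S ->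
      avoid R S L z <= 32^-1.
    move=> Sj zS; apply: (avoid_upper deg_pos c01 gap deg_le T1 _ LT zS).
    rewrite Sj natrX /T -/n.
    have -> : c * (K * n * (3 / 4) ^+ j) = 128 * C * n * (3 / 4) ^+ j.
      by rewrite /K; field; rewrite gt_eqF.
    set A := 128 * C * n.
    have -> : (A * (3 / 4) ^+ j) ^+ 2 * 2 ^+ j = A ^+ 2 * (((3 / 4) ^+ j) ^+ 2 * 2 ^+ j).
      by ring.
    (* What remains is that (3/4)^2 * 2 = 9/8 is at least 1. *)
    rewrite ler_peMr ?sqr_ge0// -exprM mulnC exprM -exprMn.
    by apply: exprn_ege1; lra.
  have := @fails_halving R G I (2 ^ j) L N (B j) _ (B0 j) IH _ s' ws'.
  rewrite expn_gt0 -expnS => H; apply: le_trans (H isT _ sj) _.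
    move=> s2 ws2 s2j; apply: Ex_many_active => //; first by rewrite -expnS.
    by move=> S i z; rewrite count_rounds; exact: avoidL.
  have DT : D * (3 / 4) ^+ j = 128 * T j by rewrite /D /T; ring.
  rewrite /B exprS; lra.
have Jn := trunc_log_ltn #|G| (isT : (1 < 2)%N).
apply: (@le_trans _ _ (B (trunc_log 2 #|G|).+1)).
  apply: claim => //.
    move=> j; rewrite ltnS => jJ; apply: leq_trans (trunc_logP (isT : (1 < 2)%N) G0).
    by rewrite leq_exp2l.
  apply: leq_ltn_trans Jn; case/andP: ws => /eqP <- _; exact: leq_addl.
rewrite /B -/K -/D -[leRHS]mulr1; apply: ler_wpM2l; first by rewrite mulr_ge0.
by rewrite gerBl; case/andP: (p01 (trunc_log 2 #|G|).+1).
Qed.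

End ParallelBound.

(** * Trajectories and schedules *)

Section Run.
Variables (G : sgraph) (n : nat).

Definition incr (a : nat -> nat) (i : nat) : nat -> nat :=
  fun k => if k == i then (a k).+1 else a k.

(* The schedule l applied to the trajectories x, where a i is the index of the
   next position of particle i to be read. *)
Fixpoint run (x : nat -> nat -> G) (l : seq 'I_n) (a : nat -> nat)
    (s : state G 'I_n) : state G 'I_n :=
  if l is i :: l' then
    if s.2 i is Some _ then run x l' (incr a i) (move s i (x i (a i)))
    else run x l' a s
  else s.
End Run.

(** * Law of the walks and of a scheduled process *)

Section Link.
Context (R : realType) (d : measure_display) (Omega : measurableType d)
  (P : probability Omega R) (G : sgraph) (v : G) (X : nat -> nat -> Omega -> G).
Hypothesis walks : idla_walks P v X.
Let n := #|G|.
Implicit Types (a : nat -> nat) (p : nat -> nat -> G) (B : set Omega).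

Definition pr B : R := fine (P B).

Lemma prE B : measurable B -> P B = (pr B)%:E.
Proof. by move=> mB; rewrite fineK// fin_num_measure. Qed.

Lemma measurable_position i t y : (i < n)%N -> measurable [set w | X i t w = y].
Proof. by move=> hi; have [/(_ i hi)[]] := walks. Qed.

Lemma pr_split B i t : (i < n)%N -> measurable B ->
  pr B = \sum_(y : G) pr (B `&` [set w | X i t w = y]).
Proof.
move=> hi mB; have mBy y : measurable (B `&` [set w | X i t w = y]).
  by apply: measurableI => //; exact: measurable_position.
apply: EFin_inj; rewrite -prE// -sumEFin.
have {1}-> : B = \bigcup_(y in [set: G]) (B `&` [set w | X i t w = y]).
  by apply/seteqP; split => [w Bw|w [y _ []//]]; exists (X i t w).
rewrite measure_fin_bigcup//; last first.
- by move=> y y' _ _ [w [[_ /= <-] [_ /= <-]]].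
- exact: finite_finset.
rewrite fsbig_finite; last exact: finite_finset.
rewrite (perm_big (index_enum G)) /=; first by apply: eq_bigr => y _; rewrite prE.
apply: uniq_perm; [exact: finmap.fset_uniq|exact: index_enum_uniq|].
move=> y; rewrite mem_index_enum.
have := in_fset_set (@finite_finset G [set: G]) y.
by rewrite in_setT.
Qed.

(** Each particle has its own horizon [a i], since a schedule reads the walks at different
    speeds. *)
Definition cyl a p : set Omega :=
  [set w | forall i t, (i < n)%N -> (t < a i)%N -> X i t w = p i t].

Lemma measurable_cyl a p : measurable (cyl a p).
Proof.
have -> : cyl a p = \bigcap_i \bigcap_t
   [set w | (i < n)%N -> (t < a i)%N -> X i t w = p i t].
  by apply/seteqP; split => [w H i _ t _ /= hi ht|w H i t]; [exact: H|exact: (H i I t I)].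
apply: bigcapT_measurable => i; apply: bigcapT_measurable => t.
have [hi|hi] := boolP (i < n)%N; last first.
  by rewrite [X in measurable X](_ : _ = setT)//; apply/seteqP; split.
have [ht|ht] := boolP (t < a i)%N; last first.
  by rewrite [X in measurable X](_ : _ = setT)//; apply/seteqP; split.
rewrite [X in measurable X](_ : _ = [set w | X i t w = p i t]).
  exact: measurable_position.
by apply/seteqP; split => [w|w Xw _ _]//=; exact.
Qed.

(** Time 0 counts as a step to [v], so that every position carries one factor. *)
Definition step_weight (q : nat -> G) t y : R :=
  if t is t'.+1 then step_prob R (q t') y else (y == v)%:R.

Lemma sum_step_weight q t : \sum_y step_weight q t y = 1.
Proof.
case: t => [|t]; last exact: sum_step_prob.
by rewrite (bigD1 v)//= eqxx big1 ?addr0// => y /negPf ->.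
Qed.

Definition cyl_weight a p : R :=
  \prod_(i < n) \prod_(t < a i) step_weight (p i) t (p i t).

Definition upd p (i t : nat) y : nat -> nat -> G :=
  fun k u => if (k == i) && (u == t) then y else p k u.

Lemma cyl_incr a p i y : (i < n)%N ->
  cyl a p `&` [set w | X i (a i) w = y] = cyl (incr a i) (upd p i (a i) y).
Proof.
move=> hi; apply/seteqP; split => [w [cw Xw] k t hk|w cw].
  rewrite /incr /upd; have [->|ki] := eqVneq k i; last exact: cw.
  by rewrite ltnS leq_eqVlt /=; have [->//|_ /=] := eqVneq t (a i); exact: cw.
split=> [k t hk ht|/=].
  rewrite cw// /upd ?/incr; last by case: ifP => // _; rewrite ltnW.
  by case: andP => // -[/eqP ki /eqP ta]; move: ht; rewrite ki ta ltnn.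
by rewrite cw// /upd /incr ?eqxx.
Qed.

Lemma cyl_weight_incr a p i y : (i < n)%N ->
  cyl_weight (incr a i) (upd p i (a i) y) = cyl_weight a p * step_weight (p i) (a i) y.
Proof.
move=> hi; pose i0 := Ordinal hi; rewrite /cyl_weight.
rewrite (bigD1 i0)//= [in RHS](bigD1 i0)//= [in RHS]mulrAC; congr (_ * _).
  rewrite /incr eqxx big_ord_recr /=; congr (_ * _).
    apply: eq_bigr => t _; rewrite /upd eqxx /= (ltn_eqF (ltn_ord t)).
    by case: t => -[|t] //= ht; rewrite (ltn_eqF (ltnW ht)).
  rewrite /upd !eqxx /=; case: (a i) => [|t] //=.
  by rewrite ?eqxx /= (ltn_eqF (ltnSn t)).
apply: eq_bigr => k; rewrite -val_eqE /= => /negPf ki; rewrite /incr ki.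
apply: eq_bigr => t _; rewrite /upd ki /=.
by case: (nat_of_ord t) => //= t'; rewrite ?ki.
Qed.

Lemma pr_cyl_full m p : pr (cyl (fun=> m.+1) p) = cyl_weight (fun=> m.+1) p.
Proof.
have [srw indep] := walks.
have -> : cyl (fun=> m.+1) p = \bigcap_(i in `I_n) path_event (X i) m (p i).
  by apply/seteqP; split => [w cw i hi t tm|w cw i t hi tm]; [exact: cw|exact: (cw i hi t tm)].
rewrite /pr indep.
rewrite (eq_bigr (fun i : 'I_n => (\prod_(t < m.+1) step_weight (p i) t (p i t))%:E)).
  by rewrite prodEFin.
move=> i _; have [_ ->] := srw i (ltn_ord i).
by rewrite big_ord_recl.
Qed.

(** Induction from a common horizon, where independence applies: a shorter cylinder is the disjoint
    union of its extensions by one position, whose weights sum to 1. *)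
Lemma pr_cyl a p : pr (cyl a p) = cyl_weight a p.
Proof.
pose m := (\max_(i < n) a i)%N.
have am (i : 'I_n) : (a i <= m.+1)%N by rewrite ltnW// ltnS leq_bigmax.
move: am; have [k] := ubnP (\sum_(i < n) (m.+1 - a i))%N.
elim: k a p {m} (m) => // k IH a p m; rewrite ltnS => ak am.
have [/existsP[i im]|] := boolP [exists i : 'I_n, (a i < m.+1)%N].
  rewrite (@pr_split _ i (a i))//; last exact: measurable_cyl.
  under eq_bigr => y _.
    rewrite cyl_incr// (IH _ _ m); first over.
      apply: leq_trans ak; rewrite (bigD1 i)//= [X in (_ < X)%N](bigD1 i)//=.
      rewrite -addSn leq_add//; first by rewrite /incr eqxx subnSK.
      apply: leq_sum => j _; apply: leq_sub2l; rewrite /incr; case: ifP => //.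
    by move=> j; rewrite /incr; case: eqP => [->|].
  under eq_bigr do rewrite cyl_weight_incr//.
  by rewrite -mulr_sumr sum_step_weight mulr1.
rewrite negb_exists => /forallP H.
have aE (i : 'I_n) : a i = m.+1.
  by apply/eqP; rewrite eqn_leq am /= leqNgt.
have -> : cyl a p = cyl (fun=> m.+1) p.
  apply/seteqP; split => w cw i t hi ht; apply: cw => //.
    by rewrite (aE (Ordinal hi)).
  by rewrite -(aE (Ordinal hi)).
rewrite pr_cyl_full; apply: eq_bigr => i _; by rewrite aE.
Qed.

Lemma measurable_run l a (s : state G 'I_n) (phi : pred (state G 'I_n)) :
  measurable [set w | phi (run (fun i t => X i t w) l a s)].
Proof.
elim: l a s => [|i l IH] a s /=.
  case: (phi s); last by rewrite [X in measurable X](_ : _ = set0)//; apply/seteqP; split.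
  by rewrite [X in measurable X](_ : _ = setT)//; apply/seteqP; split.
case E : (s.2 i) => [z|]; last exact: IH.
rewrite [X in measurable X](_ : _ = \bigcup_(y in [set: G])
  ([set w | X i (a i) w = y] `&`
   [set w | phi (run (fun i t => X i t w) l (incr a i) (move s i y))])).
  apply: fin_bigcup_measurable; first exact: finite_finset.
  by move=> y _; apply: measurableI; [exact: measurable_position|exact: IH].
apply/seteqP; split => [w H|w [y _ [/= <-]]]//=.
by exists (X i (a i) w).
Qed.

(* The Markov property at the current state of the process. *)
Lemma pr_run l a p (s : state G 'I_n) (phi : pred (state G 'I_n)) :
  (forall i : 'I_n, s.2 i != None -> (0 < a i)%N /\ s.2 i = Some (p i (a i).-1)) ->
  pr (cyl a p `&` [set w | phi (run (fun i t => X i t w) l a s)]) =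
  pr (cyl a p) * Ex l (fun s' => (phi s')%:R) s.
Proof.
elim: l a p s => [|i l IH] a p s sE /=.
  case: (phi s).
    by rewrite mulr1; congr pr; apply/seteqP; split => [w []|w].
  by rewrite mulr0 /pr [X in P X](_ : _ = set0) ?measure0//; apply/seteqP; split => [w []|w].
case E : (s.2 i) => [z|]; last exact: IH.
have [ai Ez] : (0 < a i)%N /\ s.2 i = Some (p i (a i).-1) by apply: sE; rewrite E.
have mB : measurable (cyl a p `&` [set w | phi (run (fun i t => X i t w) l (incr a i)
     (move s i (X i (a i) w)))]).
  apply: measurableI; first exact: measurable_cyl.
  by have := measurable_run (i :: l) a s phi; rewrite /= E.
rewrite (pr_split (a i) (ltn_ord i) mB) /avg mulr_sumr; apply: eq_bigr => y _.
have -> : cyl a p `&` [set w | phi (run (fun i t => X i t w) l (incr a i)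
     (move s i (X i (a i) w)))] `&` [set w | X i (a i) w = y] =
  cyl (incr a i) (upd p i (a i) y) `&`
     [set w | phi (run (fun i t => X i t w) l (incr a i) (move s i y))].
  rewrite -cyl_incr//; apply/seteqP; split => w /=.
    by move=> [[cw H] Xy]; rewrite -{2}Xy.
  by move=> [[cw Xy] H]; rewrite Xy.
rewrite IH.
  rewrite !pr_cyl cyl_weight_incr// mulrA; congr (_ * _ * _).
  rewrite E in Ez; case: Ez => ->.
  by case: (a i) ai.
move=> k; rewrite ffunE /incr /upd.
have [->|ki] := eqVneq k i.
  by rewrite !eqxx /=; case: ifP.
rewrite -val_eqE /= in ki; rewrite (negPf ki) /=; exact: sE.
Qed.

End Link.

(** * The two dispersion processes as schedules *)

Lemma first_time_le (R : realType) (Q : pred nat) T :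
  (time_value R (first_time Q) <= (T%:R)%:E)%E <-> exists2 t, (t <= T)%N & Q t.
Proof.
rewrite /first_time; case: pselect => [h|h] /=; last first.
  by rewrite leye_eq; split => // -[t _ Qt]; case: h; exists t.
rewrite lee_fin ler_nat; case: ex_minnP => m Qm minm; split.
  by move=> mT; exists m.
by move=> [t tT Qt]; apply: leq_trans tT; exact: minm.
Qed.

Lemma first_time_Some (Q : pred nat) t : Q t -> (forall u, (u < t)%N -> ~~ Q u) ->
  first_time Q = Some t.
Proof.
move=> Qt minQ; rewrite /first_time; case: pselect => [h|[]]; last by exists t.
case: ex_minnP => m Qm minm; congr Some; apply/eqP; rewrite eqn_leq minm//=.
by rewrite leqNgt; apply/negP => /minQ; rewrite Qm.
Qed.

Section Deterministic.
Variables (G : sgraph) (v : G) (x : nat -> nat -> G).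
Local Notation n := #|G|.
Local Notation st := (par_state v x).
Implicit Types (s : state G 'I_n) (l : seq 'I_n) (a : nat -> nat).

Definition start : state G 'I_n :=
  ([set v]%SET, [ffun i : 'I_n => if nat_of_ord i == 0%N then None else Some v]).

Lemma drop_enum_ord (k : 'I_n) : drop k (enum 'I_n) = k :: drop k.+1 (enum 'I_n).
Proof. by rewrite (drop_nth k) ?size_enum_ord// nth_ord_enum. Qed.

Lemma run_inactive m i l a s : s.2 i = None -> run x (nseq m i ++ l) a s = run x l a s.
Proof. by move=> si; elim: m => //= m IH; rewrite si. Qed.

Lemma run_absent l a s k : s.2 k != None -> k \notin l -> done (run x l a s) = false.
Proof.
elim: l a s => [|i l IH] a s sk /=; first by rewrite (not_done sk).
rewrite inE negb_or => /andP[ki kl]; case E : (s.2 i) => [z|]; last exact: IH.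
by apply: IH => //; rewrite ffunE (negPf ki).
Qed.

(** The set of the same name inside [par_step], for round [t.+1]. *)
Definition settling t : {set 'I_n} :=
  [set i : 'I_n | [&& i \notin (st t).2, x i t.+1 \notin (st t).1 &
    [forall j : 'I_n, ((j < i)%N && (j \notin (st t).2)) ==> (x j t.+1 != x i t.+1)]]]%SET.

Lemma par_stateS t : st t.+1 =
  ((st t).1 :|: [set x (nat_of_ord i) t.+1 | i in settling t], (st t).2 :|: settling t)%SET.
Proof. by []. Qed.

Definition early t k : {set 'I_n} := [set j in settling t | (j < k)%N]%SET.

(** The simultaneous rule agrees with moving in index order: if a smaller unsettled particle reaches
    the same vacant vertex, the smallest such particle has already settled there. *)
Lemma settlingP t (i : 'I_n) : i \notin (st t).2 ->
  (i \in settling t) = (x i t.+1 \notin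
     ((st t).1 :|: [set x (nat_of_ord j) t.+1 | j in early t i])%SET).
Proof.
move=> ni; rewrite inE ni /= finset.in_setU negb_or.
case: (boolP (x i t.+1 \notin (st t).1)) => //= xi.
apply/forallP/negP => [H /imsetP[j]|H j].
  rewrite !inE => /andP[/and3P[jn _ _] ji] xij.
  by have := H j; rewrite ji jn xij eqxx.
apply/implyP => /andP[ji jn]; apply/negP => /eqP xji; apply: H; apply/imsetP.
pose Q (k : 'I_n) := (k \notin (st t).2) && (x k t.+1 == x i t.+1).
have Qj : Q j by rewrite /Q jn xji eqxx.
have [k /andP[kn /eqP xk] kmin] := @arg_minnP _ j Q (fun k : 'I_n => nat_of_ord k) Qj.
exists k => //; rewrite inE; apply/andP; split; last exact: leq_ltn_trans (kmin j Qj) ji.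
rewrite inE kn xk xi /=; apply/forallP => u; apply/implyP => /andP[uk un].
apply/negP => xu; have := kmin u; rewrite /Q un xu => /(_ isT).
by rewrite leqNgt uk.
Qed.

(* The state in the middle of round t + 1, when the particles smaller than k
   have moved. *)
Definition mid_round k t s a : Prop :=
  [/\ s.1 = ((st t).1 :|: [set x (nat_of_ord j) t.+1 | j in early t k])%SET,
      forall j : 'I_n, (s.2 j != None) = (j \notin (st (if (j < k)%N then t.+1 else t)).2)
    & forall j : 'I_n, s.2 j != None -> a j = if (j < k)%N then t.+2 else t.+1].

Lemma early0 t : early t 0 = finset.set0.
Proof. by apply/setP => j; rewrite !inE andbF. Qed.

Lemma early_last t : early t n = settling t.
Proof. by apply/setP => j; rewrite inE ltn_ord andbT. Qed.

Lemma earlyS t (k : 'I_n) :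
  early t k.+1 = (if k \in settling t then k |: early t k else early t k)%SET.
Proof.
apply/setP => j; case: ifP => ks; rewrite ?in_setU1 !inE ltnS leq_eqVlt val_eqE.
  by have [->|] := eqVneq j k; rewrite /= ?andbT//; move: ks; rewrite inE.
by have [->|] := eqVneq j k => //=; move: ks; rewrite inE ltnn andbF andbT.
Qed.

Lemma mid_round_step (k : 'I_n) t s a l : mid_round k t s a ->
  exists s' a', mid_round k.+1 t s' a' /\ run x (k :: l) a s = run x l a' s'.
Proof.
move=> [s1 s2 sa].
have lt_ki (j : 'I_n) : j != k -> (j < k.+1)%N = (j < k)%N.
  by move=> jk; rewrite ltnS leq_eqVlt val_eqE (negPf jk).
have sk := s2 k; rewrite ltnn in sk.
case E : (s.2 k) => [z|] /=; rewrite E in sk *.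
  have kn : k \notin (st t).2 by rewrite -sk.
  have ak : a k = t.+1 by rewrite sa ?E// ltnn.
  exists (move s k (x k t.+1)), (incr a k); rewrite ak; split => //; split.
  - rewrite earlyS settlingP// -s1 /=; case: ifP => [_|/negbFE xk].
      by rewrite imsetU1 finset.setUCA -s1.
    by rewrite -s1; apply/finset.setUidPr; rewrite finset.sub1set.
  - move=> j; rewrite ffunE; have [->|jk] := eqVneq j k; last by rewrite lt_ki// s2.
    rewrite ltnSn par_stateS /= finset.in_setU negb_or kn /= settlingP// negbK -s1.
    by case: ifP.
  - move=> j; rewrite ffunE /incr val_eqE; have [->|jk] := eqVneq j k.
      by rewrite ltnSn ak.
    by rewrite lt_ki//; exact: sa.
exists s, a; split => //.
have kn : k \in (st t).2 by apply/negbNE; rewrite -sk.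
have ks : (k \in settling t) = false by rewrite inE kn.
split; first by rewrite earlyS ks.
- move=> j; have [->|jk] := eqVneq j k; last by rewrite lt_ki// s2.
  by rewrite ltnSn E par_stateS finset.in_setU kn.
- move=> j sj; have jk : j != k by apply: contraTneq sj => ->; rewrite E.
  by rewrite lt_ki//; exact: sa.
Qed.

Lemma mid_round_end t s a l k : (k <= n)%N -> mid_round k t s a ->
  exists s' a', mid_round 0 t.+1 s' a' /\ run x (drop k (enum 'I_n) ++ l) a s = run x l a' s'.
Proof.
have [m] := ubnP (n - k)%N; elim: m k s a => // m IH k s a; rewrite ltnS => km kn M.
move: kn; rewrite leq_eqVlt => /orP[/eqP kn|kn]; last first.
  rewrite (drop_enum_ord (Ordinal kn)).
  have [s' [a' [M' ->]]] := @mid_round_step (Ordinal kn) t s a (drop k.+1 (enum 'I_n) ++ l) M.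
  apply: IH => //; apply: leq_trans km; by rewrite subnSK.
exists s, a; rewrite kn drop_oversize ?size_enum_ord//; split => //.
case: M => s1 s2 sa; split.
- by rewrite s1 kn early_last par_stateS early0 imset0 finset.setU0.
- by move=> j; rewrite s2 kn ltn_ord.
- by move=> j sj; rewrite sa// kn ltn_ord.
Qed.

Lemma mid_round_rounds T t s a : mid_round 0 t s a ->
  done (run x (rounds 'I_n T) a s) = ((st (t + T)).2 == [set: 'I_n]%SET).
Proof.
elim: T t s a => [|T IH] t s a M.
  rewrite addn0 /=; case: M => _ s2 _; apply/forallP/eqP => [H|H i].
    apply/setP => i; rewrite finset.in_setT; have := s2 i.
    by rewrite (eqP (H i)) => /esym/negbFE.
  by rewrite -[_ == _]negbK s2 H finset.in_setT.
have [s' [a' [M' E]]] := mid_round_end (rounds 'I_n T) (leq0n n) M.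
by rewrite addnS -addSn -(IH _ _ _ M') -E drop0.
Qed.

Lemma done_rounds T :
  done (run x (rounds 'I_n T) (fun=> 1%N) start) = ((st T).2 == [set: 'I_n]%SET).
Proof.
rewrite -[T in RHS]add0n; apply: mid_round_rounds; split => //=.
  by rewrite early0 imset0 finset.setU0.
by move=> j; rewrite ffunE inE; case: (nat_of_ord j).
Qed.

Lemma tau_par_le (R : realType) T : (tau_par R v x <= (T%:R)%:E)%E <->
  done (run x (rounds 'I_n T) (fun=> 1%N) start).
Proof.
rewrite done_rounds; apply: (iff_trans (first_time_le _ _ _)); split; last by exists T.
(* The set of settled particles grows with time, so completeness at [t] persists until [T]. *)
move=> [t tT /eqP H]; rewrite -finset.subTset -H; move: tT {H}.
elim: T => [|T IH]; first by rewrite leqn0 => /eqP ->.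
rewrite leq_eqVlt => /orP[/eqP -> //|]; rewrite ltnS => /IH.
by move=> /fintype.subset_trans; apply; rewrite par_stateS finset.subsetUl.
Qed.

(** The occupied set is constant until the particle settles, so the first position outside [s.1]
    decides; the rest of the block is idle. *)
Lemma run_particle m i l a s : s.2 i != None ->
  (exists t s' a', [/\ (a i <= t < a i + m)%N, x i t \notin s.1,
     forall u, (a i <= u < t)%N -> x i u \in s.1 &
     [/\ run x (nseq m i ++ l) a s = run x l a' s', s'.1 = (x i t |: s.1)%SET,
         s'.2 i = None,
         forall j, j != i -> s'.2 j = s.2 j & forall j : 'I_n, j != i -> a' j = a j]]) \/
  (forall u, (a i <= u < a i + m)%N -> x i u \in s.1) /\
  exists s' a', run x (nseq m i ++ l) a s = run x l a' s' /\ s'.2 i != None.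
Proof.
elim: m a s => [|m IH] a s si.
  by right; split; [move=> u; rewrite addn0 ltnNge andbN|exists s, a].
case E : (s.2 i) (si) => [z|] //= _; rewrite E.
have [xs|xs] := boolP (x i (a i) \in s.1); last first.
  left; exists (a i), (move s i (x i (a i))), (incr a i); split => //.
  - by rewrite leqnn /= addnS ltnS leq_addr.
  - by move=> u; rewrite ltnNge andbN.
  - split => //.
    + by rewrite run_inactive// ffunE eqxx (negPf xs).
    + by rewrite ffunE eqxx (negPf xs).
    + by move=> j ji; rewrite ffunE (negPf ji).
    + by move=> j ji; rewrite /incr val_eqE (negPf ji).
have := IH (incr a i) (move s i (x i (a i))); rewrite ffunE eqxx xs => /(_ isT).
have s1 : (move s i (x i (a i))).1 = s.1 by apply/finset.setUidPr; rewrite finset.sub1set.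
have ii : incr a i i = (a i).+1 by rewrite /incr eqxx.
rewrite s1 ii => -[[t [s' [a' [tm xt xu [r s'1 s'i s'j a'j]]]]]|[xu [s' [a' [r s'i]]]]].
  left; exists t, s', a'; split => //.
  - by case/andP: tm => /ltnW -> /=; rewrite addnS -addSn.
  - move=> u /andP[]; rewrite leq_eqVlt => /orP[/eqP <- //|au ut].
    by apply: xu; rewrite au.
  - split => //; first by move=> j ji; rewrite s'j// ffunE (negPf ji).
    by move=> j ji; rewrite a'j// /incr val_eqE (negPf ji).
right; split; last by exists s', a'.
move=> u /andP[]; rewrite leq_eqVlt => /orP[/eqP <- //|au um].
by apply: xu; rewrite au addSn -addnS.
Qed.

Lemma seq_occupied_start i : v \in seq_occupied v x i.
Proof.
elim: i => [|i IH] /=; first exact: set11.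
by case: settling_time => // t; rewrite in_setU1 IH orbT.
Qed.

Definition settles_by T i : Prop :=
  exists2 t, (t <= T)%N & x i t \notin seq_occupied v x i.-1.

(** Induction on the particles still to be released. [a0] counts initial positions known to be [v],
    which need not be read; a particle that exhausts its block unsettled has no later turn. *)
Lemma done_one_by_one_from (a0 T k : nat) s a : (0 < k)%N -> (k <= n)%N -> (a0 <= T.+1)%N ->
  (forall i t, (i < n)%N -> (t < a0)%N -> x i t = v) ->
  s.1 = seq_occupied v x k.-1 ->
  (forall j : 'I_n, (s.2 j != None) = (k <= j)%N) ->
  (forall j : 'I_n, (k <= j)%N -> a j = a0) ->
  done (run x (flatten [seq nseq (T.+1 - a0) i | i <- drop k (enum 'I_n)]) a s) <->
  (forall i, (k <= i < n)%N -> settles_by T i).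
Proof.
move=> k0 + a0T xv; have [m] := ubnP (n - k)%N.
elim: m k k0 s a => // m IH k k0 s a; rewrite ltnS => km kn s1 s2 sa.
move: kn; rewrite leq_eqVlt => /orP[/eqP kn|kn].
  rewrite kn drop_oversize ?size_enum_ord//=; split => [_ i|_].
    by rewrite leqNgt andNb.
  apply/forallP => j; apply/negbNE; rewrite s2 kn -ltnNge; exact: ltn_ord.
pose i : 'I_n := Ordinal kn.
rewrite (drop_enum_ord i) /=.
have si : s.2 i != None by rewrite s2 /=.
have ai : a i = a0 by apply: sa.
have early u : (u < a0)%N -> x k u \in s.1.
  by move=> ua; rewrite xv// s1; exact: seq_occupied_start.
set rest := flatten _.
have irest : i \notin rest.
  apply/flattenP => -[r /mapP[j jin ->]] /nseqP[ij _].
  have := drop_uniq k (enum_uniq 'I_n); rewrite (drop_enum_ord i) /=.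
  by rewrite ij jin.
have [[t [s' [a' [tm xt xu [-> s'1 s'i s'j a'j]]]]]|[xu [s' [a' [-> s'i]]]]] :=
   run_particle (T.+1 - a0) rest a si; last first.
  rewrite (run_absent _ s'i irest); split => // H.
  have [|t tT] := H k; first by rewrite leqnn.
  rewrite -s1; have [ta|ta] := ltnP t a0; first by rewrite early.
  by rewrite xu// ai ta subnKC.
rewrite ai subnKC// in tm; rewrite ai in xu.
have settled_at : settling_time (seq_occupied v x k.-1) (x k) = Some t.
  apply: first_time_Some; first by rewrite -s1.
  move=> u ut; rewrite negbK -s1; have [ua|ua] := ltnP u a0; first exact: early.
  by apply: xu; rewrite ua.
have occ : seq_occupied v x k = (x k t |: seq_occupied v x k.-1)%SET.
  by case: (k) k0 settled_at => // k' _ /= ->.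
rewrite IH//; last first.
- by move=> j kj; rewrite a'j ?sa// ?(ltnW kj)// -val_eqE gtn_eqF.
- move=> j; have [->|ji] := eqVneq j i; first by rewrite s'i /= ltnn.
  move: (ji); rewrite -val_eqE /= => jk.
  by rewrite s'j// s2 ltn_neqAle eq_sym jk.
- by rewrite s'1 s1 -occ.
- by apply: leq_trans km; rewrite subnSK.
split=> H j.
  move=> /andP[]; rewrite leq_eqVlt => /orP[/eqP <- _|kj jn]; last by apply: H; rewrite kj.
  by exists t; rewrite -?s1//; case/andP: tm.
by move=> /andP[kj jn]; apply: H; rewrite (ltnW kj).
Qed.

Lemma done_one_by_one (a0 T : nat) : (0 < n)%N -> (a0 <= T.+1)%N ->
  (forall i t, (i < n)%N -> (t < a0)%N -> x i t = v) ->
  done (run x (one_by_one 'I_n (T.+1 - a0)) (fun=> a0) start) <->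
  (forall i, (0 < i < n)%N -> settles_by T i).
Proof.
move=> n0 a0T xv; rewrite /one_by_one -(drop0 (enum 'I_n)) (drop_enum_ord (Ordinal n0)) /=.
rewrite run_inactive; last by rewrite ffunE.
apply: done_one_by_one_from => //.
by move=> j; rewrite /start /= ffunE; case: (nat_of_ord j).
Qed.

Lemma tau_seq_le (R : realType) T : (tau_seq R v x <= (T%:R)%:E)%E <->
  (forall i, (0 < i < n)%N -> settles_by T i).
Proof.
have settle i : (time_value R (settling_time (seq_occupied v x i.-1) (x i)) <= T%:R%:E)%E <->
    settles_by T i by exact: first_time_le.
split=> [H i /andP[i0 iN]|H].
  apply/settle; apply: le_trans H.
  have : i \in index_iota 1 n by rewrite mem_index_iota i0.
  rewrite /tau_seq; elim: (index_iota 1 n) => // j r IH.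
  rewrite inE big_cons le_max => /orP[/eqP <-|/IH ->]; last by rewrite orbT.
  by rewrite lexx.
rewrite /tau_seq big_seq; apply: bigmax_le => [|i]; first by rewrite lee_fin.
by rewrite mem_index_iota => /H/settle.
Qed.

End Deterministic.

(** * Expected dispersion times *)

Section TailSum.
Context (R : realType) (d : measure_display) (Omega : measurableType d)
  (P : probability Omega R) (tau : Omega -> \bar R).
Hypotheses (tau_time : forall w, exists o, tau w = time_value R o)
  (tau_meas : forall T : nat, measurable [set w | (tau w <= (T%:R)%:E)%E]).
Let late (T : nat) : set Omega := ~` [set w | (tau w <= (T%:R)%:E)%E].

(** An integer or infinite time is the number of integers [T] below it. *)
Lemma tau_series w : tau w = (\sum_(0 <= T <oo) (\1_(late T) w)%:E)%E.
Proof.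
have ind0 (T : nat) : (0 <= (\1_(late T) w)%:E :> \bar R)%E.
  by rewrite lee_fin indicE ler0n.
have part (N : nat) : ((N%:R)%:E <= tau w)%E ->
    (\sum_(0 <= T < N) (\1_(late T) w)%:E)%E = (N%:R)%:E :> \bar R.
  move=> Nt; rewrite sumEFin big_nat (eq_bigr (fun=> 1)); last first.
    move=> T /andP[_ TN]; rewrite indicE mem_set//= /late /= => tT.
    by have := le_trans Nt tT; rewrite lee_fin ler_nat leqNgt TN.
  by rewrite -big_nat sumr_const_nat subn0.
have [[t tE|tE]] := tau_time w.
  apply/eqP; rewrite eq_le; apply/andP; split.
    have := nneseries_lim_ge t (fun T (_ : (0 <= T)%N) (_ : true) => ind0 T).
    by rewrite part tE.
  apply: lime_le; first exact: is_cvg_nneseries.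
  apply: nearW => N; have [Nt|tN] := leqP N t.
    by rewrite part tE ?lee_fin ler_nat.
  rewrite (big_cat_nat (leq0n t) (ltnW tN)) /= part ?tE// [X in (_ + X)%E]big_nat big1 ?adde0//.
  move=> T /andP[tT _]; rewrite indicE memNset// /late /= => H; apply: H.
  by rewrite tE lee_fin ler_nat.
rewrite tE; apply/esym/eqyP => A A0.
have [N AN] : exists N : nat, A <= N%:R by exists (Num.truncn A).+1; exact/ltW/truncnS_gt.
apply: (@le_trans _ _ (N%:R)%:E); first by rewrite lee_fin.
have := nneseries_lim_ge N (fun T (_ : (0 <= T)%N) (_ : true) => ind0 T).
by rewrite part// tE leey.
Qed.

Lemma late_meas T : measurable (late T).
Proof. exact: measurableC. Qed.

Lemma mean_time_series :
  (\int[P]_w tau w)%E = (\sum_(0 <= T <oo) P (late T))%E.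
Proof.
under eq_integral do rewrite tau_series.
rewrite integral_nneseries//.
- by apply: eq_eseriesr => T _; rewrite integral_indic ?setIT//; exact: late_meas.
- move=> T; apply/measurable_realfun.measurable_EFinP; apply: measurable_realfun.measurable_indic; exact: late_meas.
Qed.

Lemma mean_time_le (b : R) :
  (forall N, (\sum_(T < N) P (late T) <= b%:E)%E) -> (\int[P]_w tau w <= b%:E)%E.
Proof.
move=> H; rewrite mean_time_series; apply: lime_le.
  by apply: is_cvg_nneseries => T _ _; exact: measure_ge0.
by apply: nearW => N; rewrite big_mkord; exact: H.
Qed.

(** Tails decrease, so each of the first [T.+1] terms is at least [b]. *)
Lemma mean_time_ge (b : R) T : (b%:E <= P (late T))%E ->
  ((T.+1%:R * b)%:E <= \int[P]_w tau w)%E.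
Proof.
move=> H; rewrite mean_time_series.
apply: le_trans (nneseries_lim_ge T.+1 _); last by move=> ? _ _; exact: measure_ge0.
apply: (@le_trans _ _ (\sum_(0 <= t < T.+1) b%:E)%E).
  by rewrite sumEFin sumr_const_nat subn0 mulr_natl.
rewrite big_nat [leRHS]big_nat; apply: lee_sum => t /andP[_ tT].
apply: le_trans H _; apply: le_measure; [exact/mem_set/late_meas|exact/mem_set/late_meas|].
move=> w /= H H'; apply: H; apply: le_trans H' _.
by rewrite lee_fin ler_nat.
Qed.

End TailSum.

Lemma time_value_max (R : realType) o1 o2 :
  exists o, maxe (time_value R o1) (time_value R o2) = time_value R o.
Proof.
by rewrite maxEle; case: ifP => _; [exists o2|exists o1].
Qed.

Lemma tau_seq_time (R : realType) (G : sgraph) v x :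
  exists o, @tau_seq R G v x = time_value R o.
Proof.
rewrite /tau_seq; elim: (index_iota 1 #|G|) => [|i r IH].
  by exists (Some 0%N); rewrite big_nil.
by case: IH => p E; rewrite big_cons E; exact: time_value_max.
Qed.

Lemma wf_start (G : sgraph) (v : G) : wf (start v).
Proof.
have n0 : (0 < #|G|)%N by apply/card_gt0P; exists v.
apply/andP; split; last by apply/forallP => i; rewrite ffunE; case: ifP => //= _; exact: set11.
have -> : active (start v) = [set~ Ordinal n0]%SET.
  by apply/setP => i; rewrite in_active ffunE !inE -val_eqE /=; case: (nat_of_ord i).
by rewrite /= cards1 cardsC1 card_ord add1n prednK.
Qed.

(** * Distribution functions of the two dispersion times *)

Section Process.
Context (R : realType) (d : measure_display) (Omega : measurableType d)
  (P : probability Omega R) (G : sgraph) (v : G) (X : nat -> nat -> Omega -> G).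
Hypothesis walks : idla_walks P v X.
Local Notation traj := (fun w => fun i t => X i t w).

Lemma start_positions : P (cyl (G := G) X (fun=> 1%N) (fun _ _ => v)) = 1%E.
Proof.
rewrite (prE _ (measurable_cyl walks _ _)) (pr_cyl walks) /cyl_weight.
by congr EFin; apply: big1 => i _; rewrite big_ord1 /= eqxx.
Qed.

(** The walks start at [v] only almost surely; this restricts an event to the trajectories that
    do. *)
Lemma prob_start_positions (B : set Omega) : measurable B ->
  P B = P (cyl (G := G) X (fun=> 1%N) (fun _ _ => v) `&` B).
Proof.
move=> mB; set A := cyl (G := G) X (fun=> 1%N) (fun _ _ => v); have mA : measurable A by exact: measurable_cyl walks _ _.
have PA : P (~` A) = 0%E.
  by rewrite probability_setC// start_positions subee.
rewrite setIC [LHS](measureDI P mB mA).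
rewrite [X in (X + _)%E](_ : _ = 0%E) ?add0e//.
apply/eqP; rewrite eq_le measure_ge0 andbT -PA; apply: le_measure.
- by apply/mem_set; exact: measurableD.
- by apply/mem_set; exact: measurableC.
- by move=> w [].
Qed.

Lemma prob_run (l : seq 'I_#|G|) :
  P [set w | done (run (traj w) l (fun=> 1%N) (start v))] = (success R l (start v))%:E.
Proof.
have mB := measurable_run walks l (fun=> 1%N) (start v) (@done G 'I_#|G|).
rewrite prob_start_positions// prE; last first.
  by apply: measurableI => //; exact: measurable_cyl walks _ _.
rewrite (pr_run walks) /pr ?start_positions ?mul1r//.
by move=> i; rewrite ffunE; case: ifP.
Qed.

Lemma prob_tau_par T : measurable [set w | (tau_par R v (traj w) <= (T%:R)%:E)%E] /\
  P [set w | (tau_par R v (traj w) <= (T%:R)%:E)%E] =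
    (success R (rounds 'I_#|G| T) (start v))%:E.
Proof.
have -> : [set w | (tau_par R v (traj w) <= (T%:R)%:E)%E] =
   [set w | done (run (traj w) (rounds 'I_#|G| T) (fun=> 1%N) (start v))].
  by apply/seteqP; split => w /= /(@tau_par_le G v (traj w) R T).
split; last exact: prob_run.
exact: (measurable_run walks _ _ _ (@done G 'I_#|G|)).
Qed.

Lemma prob_tau_seq T : measurable [set w | (tau_seq R v (traj w) <= (T%:R)%:E)%E] /\
  P [set w | (tau_seq R v (traj w) <= (T%:R)%:E)%E] =
    (success R (one_by_one 'I_#|G| T) (start v))%:E.
Proof.
have n0 : (0 < #|G|)%N by apply/card_gt0P; exists v.
set D := [set w | _].
(* Measurability also concerns trajectories that do not start at [v], so position 0 is read as well,
   with [a0 = 0]. *)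
have mD : measurable D.
  have -> : D = [set w | done (run (traj w) (one_by_one 'I_#|G| (T.+1 - 0)) (fun=> 0%N) (start v))].
    have E w : (forall i t, (i < #|G|)%N -> (t < 0)%N -> X i t w = v) by [].
    apply/seteqP; split => w /= H.
      have := @done_one_by_one G v (traj w) 0 T n0 isT (E w) => {}E.
      by apply/E/(@tau_seq_le G v (traj w) R T).
    have := @done_one_by_one G v (traj w) 0 T n0 isT (E w) => {}E.
    by apply/(@tau_seq_le G v (traj w) R T)/E.
  exact: (measurable_run walks _ _ _ (@done G 'I_#|G|)).
(* On the almost sure event of starting at [v] reading may begin at time 1, which leaves [T] moves
   per particle. *)
split => //; rewrite prob_start_positions// -prob_run.
rewrite [RHS]prob_start_positions; last exact: (measurable_run walks _ _ _ (@done G 'I_#|G|)).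
congr (P _); apply/seteqP; split => w [Aw /= H]; split => //=.
  have E : forall i t, (i < #|G|)%N -> (t < 1)%N -> X i t w = v.
    by move=> i t hi ht; exact: Aw.
  have := @done_one_by_one G v (traj w) 1 T n0 isT E; rewrite subn1 /= => {}E.
  by apply/E/(@tau_seq_le G v (traj w) R T).
have E : forall i t, (i < #|G|)%N -> (t < 1)%N -> X i t w = v.
  by move=> i t hi ht; exact: Aw.
have := @done_one_by_one G v (traj w) 1 T n0 isT E; rewrite subn1 /= => {}E.
by apply/(@tau_seq_le G v (traj w) R T)/E.
Qed.

End Process.

(** * Degrees *)

Section Graph.
Variable G : sgraph.

Lemma min_degree_le (x : G) : (min_degree G <= degree x)%N.
Proof.
rewrite /min_degree; have := mem_index_enum x.
elim: (index_enum G) => // y r IH; rewrite inE big_cons geq_min.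
by move=> /orP[/eqP <-|/IH ->]; rewrite ?leqnn ?orbT.
Qed.

Lemma connected_degree_gt0 : connected_graph G -> (1 < #|G|)%N ->
  forall x : G, (0 < degree x)%N.
Proof.
move=> conn G1 x; have [y yx] : exists y : G, y != x.
  have /card_gt0P[y] : (0 < #|predC1 x|)%N by rewrite cardC1 -subn1 subn_gt0.
  by exists y.
have /connectP[[|z p] /=] := conn x y.
  by move=> _ yE; rewrite yE eqxx in yx.
by move=> /andP[xz _] _; apply/card_gt0P; exists z.
Qed.

Lemma deg_ratio (R : realType) (C : R) : 0 <= C ->
  (max_degree G)%:R <= C * (min_degree G)%:R ->
  forall x y : G, deg R x <= C * deg R y.
Proof.
move=> C0 H x y; apply: (@le_trans _ _ (max_degree G)%:R).
  by rewrite ler_nat; exact: (leq_bigmax x).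
by apply: le_trans H _; rewrite ler_wpM2l// ler_nat min_degree_le.
Qed.
End Graph.

(** * Mean dispersion times of order n *)

Section Bounds.
Context (R : realType) (d : measure_display) (Omega : measurableType d)
  (P : probability Omega R) (G : sgraph) (c C : R).
Hypotheses (G1 : (1 < #|G|)%N) (deg_pos : forall x : G, (0 < degree x)%N)
  (c01 : 0 < c <= 1) (C1 : 1 <= C)
  (gap : forall f : G -> R, inner f (fun=> 1) = 0 ->
           inner f (avg f) <= (1 - c) * inner f f)
  (deg_le : forall x y : G, deg R x <= C * deg R y).
Local Notation n := #|G|.

Lemma prob_late (B : set Omega) (q : R) : measurable B -> P B = q%:E ->
  P (~` B) = (1 - q)%:E.
Proof. by move=> mB PB; rewrite probability_setC// PB. Qed.

(** Any time whose distribution function dominates the parallel one is allowed, so that both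
    processes are covered. *)
Lemma mean_tau_upper v (tau : Omega -> \bar R) (p : nat -> R) :
  (forall w, exists o, tau w = time_value R o) ->
  (forall T, measurable [set w | (tau w <= (T%:R)%:E)%E] /\
     P [set w | (tau w <= (T%:R)%:E)%E] = (p T)%:E) ->
  (forall T, success R (rounds 'I_n T) (start v) <= p T) ->
  (\int[P]_w tau w <= (4 * (128 * (128 * (C / c) * n%:R)))%:E)%E.
Proof.
move=> tau_time tauP sp; apply: (@mean_time_le _ _ _ P tau) => // [T|N]; first by case: (tauP T).
rewrite (eq_bigr (fun T : 'I_N => (1 - p T)%:E)); last first.
  by move=> T _; have [mT PT] := tauP T; exact: prob_late.
rewrite sumEFin lee_fin.
apply: le_trans (fails_bound deg_pos c01 gap deg_le C1 N _ (wf_start v)); last exact: ltnW.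
by apply: ler_sum => T _; rewrite /fail lerD2l lerN2.
Qed.

(** Any time whose distribution function lies below the sequential one is allowed; the last particle
    then has to hit one vertex [u]. *)
Lemma mean_tau_lower v (tau : Omega -> \bar R) (p : nat -> R) (e : R) :
  (forall w, exists o, tau w = time_value R o) ->
  (forall T, measurable [set w | (tau w <= (T%:R)%:E)%E] /\
     P [set w | (tau w <= (T%:R)%:E)%E] = (p T)%:E) ->
  (forall T, p T <= success R (one_by_one 'I_n T) (start v)) ->
  0 < e -> (forall T u, T%:R <= n%:R * e -> u != v -> e <= avoid R [set u] T v) -> e <= 1 ->
  ((e ^+ 2 * n%:R)%:E <= \int[P]_w tau w)%E.
Proof.
move=> tau_time tauP ps e0 He e1.
set T := Num.truncn (n%:R * e).
have Te : T%:R <= n%:R * e by rewrite truncn_le mulr_ge0// ltW.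
have [mT PT] := tauP T.
apply: (@le_trans _ _ (T.+1%:R * e)%:E).
  rewrite lee_fin expr2 -mulrA mulrC ler_wpM2r ?(ltW e0)// mulrC.
  exact/ltW/truncnS_gt.
apply: (@mean_time_ge _ _ _ P tau) => //; first by move=> T'; case: (tauP T').
rewrite (prob_late mT PT) lee_fin lerBrDr -lerBrDl.
apply: le_trans (ps T) _.
have [r [k rk]] : exists r k, enum 'I_n = rcons r k.
  have : size (enum 'I_n) != 0%N by rewrite size_enum_ord -lt0n ltnW.
  by case/lastP: (enum 'I_n) => // r k _; exists r, k.
have := enum_uniq 'I_n; rewrite rk rcons_uniq => /andP[kr _].
rewrite /one_by_one rk map_rcons flatten_rcons.
(* The last index is [n.-1], positive because [n > 1]; particle 0 is already settled at the
   start. *)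
have k0 : nat_of_ord k != 0%N.
  have : last k (enum 'I_n) = k by rewrite rk last_rcons.
  rewrite -nth_last size_enum_ord => kE.
  have : nat_of_ord (nth k (enum 'I_n) n.-1) = n.-1 by rewrite nth_enum_ord// ltn_predL ltnW.
  by rewrite kE => ->; rewrite -lt0n -subn1 subn_gt0.
apply: (@success_last _ _ _ _ T _ k v e) => //; first exact: wf_start.
- by rewrite ffunE (negPf k0).
- apply/flattenP => -[r' /mapP[j jr ->]] /nseqP[kj _].
  by rewrite kj jr in kr.
- by move=> u uv; exact: He.
Qed.

End Bounds.
Theorem theorem5p5 (R : realType) (G : nat -> sgraph)
  (d : nat -> measure_display) (Omega : forall k : nat, measurableType (d k))
  (P : forall k : nat, probability (Omega k) R)
  (X : forall k : nat, G k -> nat -> nat -> Omega k -> G k)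
  (G_connected : forall k : nat, connected_graph (G k))
  (G_size : (fun k : nat => #|G k|) @ \oo --> \oo)
  (G_almost_regular : almost_regular R G)
  (G_expander : expander R G)
  (X_walks : forall (k : nat) (v : G k), idla_walks (P k) v (X k v)) :
  Theta (fun k : nat => t_seq (P k) (X k)) (fun k : nat => #|G k|%:R) /\
  Theta (fun k : nat => t_par (P k) (X k)) (fun k : nat => #|G k|%:R).
Proof.
have [C0 HC0] := G_almost_regular; have [c0 c00 Hc0] := G_expander.
(* Weakening the constants gives [C >= 1] and [c <= 1]. *)
pose C := Num.max C0 1; pose c := Num.min c0 1.
have C1 : 1 <= C by rewrite le_max lexx orbT.
have c01 : 0 < c <= 1 by rewrite lt_min c00 ltr01 ge_min lexx orbT.
have /andP[cpos cle1] := c01.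
pose e : R := (4 * (C + c^-1))^-1; pose b : R := 4 * (128 * (128 * (C / c))).
have ci : 0 < c^-1 by rewrite invr_gt0.
have Cc0 : 0 < 4 * (C + c^-1) by rewrite mulr_gt0// addr_gt0// (lt_le_trans ltr01).
have e0 : 0 < e by rewrite invr_gt0.
have e1 : e <= 1.
  rewrite invf_le1//; lra.
have b0 : 0 < b by rewrite !mulr_gt0// (lt_le_trans ltr01).
have large : \forall k \near \oo, (1 < #|G k|)%N.
  exact: (G_size _ (nbhs_infty_gt 1%N)).
suff H : \forall k \near \oo,
   [/\ ((e ^+ 2 * #|G k|%:R)%:E <= t_seq (P k) (X k))%E,
       (t_seq (P k) (X k) <= (b * #|G k|%:R)%:E)%E,
       ((e ^+ 2 * #|G k|%:R)%:E <= t_par (P k) (X k))%E &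
       (t_par (P k) (X k) <= (b * #|G k|%:R)%:E)%E].
  split; exists (e ^+ 2), b; split => //; rewrite ?exprn_gt0//.
    by near=> k; have [] : _ := near H k _.
  by near=> k; have [] : _ := near H k _.
near=> k.
have G1 : (1 < #|G k|)%N by near: k.
have gk : c0 <= 1 - lambda2 R (G k) by near: k.
have dpos := connected_degree_gt0 (G_connected k) G1.
have gap : forall f : G k -> R, inner f (fun=> 1) = 0 ->
    inner f (avg f) <= (1 - c) * inner f f.
  apply: spectral_gap => //; apply: le_trans gk; by rewrite ge_min lexx.
have dle : forall x y : G k, deg R x <= C * deg R y.
  apply: deg_ratio; first by rewrite (le_trans ler01).
  by apply: le_trans (HC0 k) _; rewrite ler_wpM2r// le_max lexx.
have [v0 Hv0] := avoid_lower dpos c01 gap dle G1.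
(* [e] is both the fraction of [n] that bounds the time and the probability of a miss, whence the
   factor [e ^+ 2]. *)
have Hv T u : T%:R <= #|G k|%:R * e -> u != v0 -> e <= avoid R [set u] T v0.
  by move=> Te uv; apply: Hv0 => //; rewrite -ler_pdivlMr.
have seqT v w : exists o, tau_seq R v (fun i t => X k v i t w) = time_value R o.
  exact: tau_seq_time.
have parT v w : exists o, tau_par R v (fun i t => X k v i t w) = time_value R o.
  by eexists.
have seqP v T := prob_tau_seq (X_walks k v) T.
have parP v T := prob_tau_par (X_walks k v) T.
have -> : b * #|G k|%:R = 4 * (128 * (128 * (C / c) * #|G k|%:R)) by rewrite /b; ring.
split.
- rewrite /t_seq; apply: le_trans (le_bigmax _ _ v0).
  by apply: (@mean_tau_lower _ _ _ _ _ G1 v0 _ _ e (seqT v0) (seqP v0)).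
- apply: bigmax_le => [|v _]; first exact: leNye.
  apply: (mean_tau_upper G1 dpos c01 C1 gap dle (v := v) (seqT v) (seqP v)).
  by move=> T; exact: rounds_le_one_by_one.
- rewrite /t_par; apply: le_trans (le_bigmax _ _ v0).
  apply: (@mean_tau_lower _ _ _ _ _ G1 v0 _ _ e (parT v0) (parP v0)) => //.
  by move=> T; exact: rounds_le_one_by_one.
- apply: bigmax_le => [|v _]; first exact: leNye.
  by apply: (mean_tau_upper G1 dpos c01 C1 gap dle (v := v) (parT v) (parP v)).
Unshelve. all: by end_near.
Qed.
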